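(* Let $D$ be a reduced alternating diagram of a prime link, with $n$ crossings and arcs $a_1,\dots,a_n$ (the last arc $a_n$ being the base arc). Let $C(D)$ be the reduced crossing matrix of $D$, let $n_1$ be the largest invariant factor of the finite abelian group $Col^{red}(D)$, and let $L_{n_1}(D)=n_1C(D)^{-1}=(c_{i,k})_{1\le i,k\le n-1}$, an integral matrix; put also $c_{n,k}=0$ for all $k$ (the base arc is colored $0$). Then for any two distinct arcs $a_i$ and $a_j$ of $D$ ($1\le i\neq j\le n$) there exists a column of $L_{n_1}(D)$ which distinguishes them modulo $n_1$, i.e. there exists $k\in\{1,\dots,n-1\}$ such that $c_{i,k}\not\equiv c_{j,k} \pmod{n_1}$.
   Context: Arcs of a link diagram are the segments running from undercrossing to undercrossing. A diagram is reduced if it has no nugatory crossing. Prime links are taken to be non-trivial and non-split, so that a reduced alternating diagram of one has non-zero determinant. $Col(D)$ is the abelian group generated by the arcs of $D$ with a relation $2b-a-c=0$ for each crossing, where $b$ is the over-arc and $a,c$ are the two under-arcs at that crossing. $Col^{trivial}(D)\cong\mathbb Z$ is the group of trivial colorings, embedded in $Col(D)$, and $Col^{red}(D)=Col(D)/Col^{trivial}(D)$ is the reduced group of Fox colorings. It can be presented by adding to the presentation of $Col(D)$ the relation that one chosen arc (the base arc) is $0$, and it is isomorphic to $H_1(M^{(2)}_L,\mathbb Z)$, where $M^{(2)}_L$ is the double cover of $S^3$ branched along $L$. It is finite when the determinant is non-zero. Its invariant factor decomposition is written $Col^{red}(D)=\mathbb Z_{n_1}\oplus\cdots\oplus\mathbb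 Z_{n_s}$ with $n_{i+1}\mid n_i$ and all $n_i>1$; thus $n_1$ is the largest invariant factor, the annihilator of the group. Crossing matrix: fix an ordering $c_1,\dots,c_n$ of the crossings of $D$. Since $D$ is reduced and alternating, each arc is the over-arc of exactly one crossing; let $a_i$ be the over-arc at $c_i$. The crossing matrix $C'(D)$ is the $n\times n$ integer matrix whose $i$-th row lists the coefficients of the relation $2b-a-c=0$ at $c_i$: the entry is $2$ in column $i$, $-1$ in the columns of the two under-arcs at $c_i$ ($-2$ if both under-arcs are the same arc), and $0$ elsewhere. The reduced crossing matrix $C(D)$ is obtained from $C'(D)$ by deleting the last row and the last column; the arc $a_n$ of the deleted column is the base arc. $C(D)$ is a presentation matrix of $Col^{red}(D)$, and the columns of $L_{n_1}(D)=n_1C(D)^{-1}$ reduced modulo $n_1$, extended by the color $0$ on the base arc, are Fox $n_1$-colorings of $D$ (maps from the arcs to $\mathbb Z_{n_1}$ satisfying $2b-a-c\equiv 0 \pmod{n_1}$ at each crossing). *)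

(* Defs.v *)
From HB Require Import structures.
From Stdlib Require Import Relation_Operators.
From mathcomp Require Import all_boot all_algebra fingroup perm ring_quotient.
From mathcomp Require Import boolp.

Set Implicit Arguments.
Unset Strict Implicit.
Unset Printing Implicit Defensive.

Import GRing.Theory.
Local Open Scope ring_scope.

(* A link diagram on the oriented sphere is encoded by its combinatorial map. *)
(* A dart is a half-edge directed away from its vertex; [opp] exchanges the   *)
(* two halves of an edge and [ccw] turns counterclockwise around a vertex.    *)
(* Every vertex is either a crossing (four darts, [over] marking the two      *)
(* opposite darts of the upper strand) or a bead (two darts, [over] being     *)
(* meaningless there). A bead is a mere point marked on a strand; beads make  *)
(* it possible to represent components without crossings.                     *)
(* The orbits of [opp * ccw] (first [opp], then [ccw]) are the faces: the     *)
(* orbit of [d] is the face containing the corner between [ccw^-1 d] and [d]. *)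

Definition linked (T : finType) (s t : {perm T}) : rel T :=
  [rel d e | (e == s d) || (e == t d)].

(* Euler's formula, which says that each connected component has genus 0. The *)
(* relative position of distinct components is not recorded: it does not      *)
(* affect the link.                                                           *)
Definition genus0 (T : finType) (ccw opp : {perm T}) : Prop :=
  (#|porbits ccw| + #|porbits (opp * ccw)%g|
     = #|porbits opp| + (n_comp (linked ccw opp) predT).*2)%N.

Record diagram := Diagram {
  dart : finType;
  ccw : {perm dart};
  opp : {perm dart};
  over : pred dart;
  opp_inv : forall d, opp (opp d) = d;
  opp_neq : forall d, opp d != d;
  ccw_order : forall d, ccw (ccw (ccw (ccw d))) = d;
  ccw_neq : forall d, ccw d != d;
  over_alt : forall d, ccw (ccw d) != d -> over (ccw d) = ~~ over d;
  planar : genus0 ccw opp }.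

Arguments ccw {_}.
Arguments opp {_}.
Arguments over {_}.

Section DiagramTheory.
Variable D : diagram.
Implicit Types (d e : dart D) (X a : {set dart D}).

Definition ccw2 d := ccw (ccw d).
Definition ccw3 d := ccw (ccw (ccw d)).

Definition at_crossing d : bool := ccw2 d != d.
Definition at_bead d : bool := ccw2 d == d.

Definition crossings : {set {set dart D}} :=
  [set X in porbits (@ccw D) | #|X| == 4].

Definition components : nat := n_comp (linked (@ccw D) opp) predT.

Definition crossings_only : Prop := forall d, at_crossing d.

Definition alternating : Prop := forall d, over (opp d) = ~~ over d.

(* A crossing is nugatory when a circle on the sphere meets the diagram only  *)
(* there, i.e. when two opposite corners of it lie in the same face.          *)
Definition nugatory d : bool :=
  at_crossing d && (ccw2 d \in porbit (opp * ccw)%g d).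

Definition reduced : Prop := forall d, ~~ nugatory d.

(* Arcs run along edges, through over-crossings and through beads, and stop   *)
(* at undercrossings; an arc is represented by the set of its darts.          *)
Definition through d := if at_crossing d then ccw2 d else ccw d.

Definition arc_step : rel (dart D) :=
  [rel d e | (e == opp d) || ((at_crossing d ==> over d) && (e == through d))].

Definition arc_of d : {set dart D} := [set e | connect arc_step d e].

Definition arcs : {set {set dart D}} := [set arc_of d | d : dart D].

Definition over_arc X : {set dart D} := \bigcup_(d in X | over d) arc_of d.

(* Coefficient of the arc [a] in the relation 2b - a1 - a2 = 0 of the         *)
(* crossing [X]: the over-arc b occupies two darts of [X] (coefficient 1      *)
(* each), the ends of the under-arcs a1 and a2 one dart each.                 *)
Definition crossing_coef X a : int :=
  \sum_(d in X :&: a) (if over d then 1 else -1).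

Definition crossing_matrix m (c : 'I_m.+1 -> {set dart D}) : 'M[int]_m.+1 :=
  \matrix_(i, k) crossing_coef (c i) (over_arc (c k)).

Definition reduced_crossing_matrix m (c : 'I_m.+1 -> {set dart D}) : 'M[int]_m :=
  row' ord_max (col' ord_max (crossing_matrix c)).

End DiagramTheory.

Definition span_pred (V : zmodType) (s : seq V) : {pred V} :=
  fun v => `[< inIntSpan (in_tuple s) v >].

Lemma span_zmod_closed (V : zmodType) (s : seq V) : zmod_closed (span_pred s).
Proof.
split=> [|u v /asboolP[a ua] /asboolP[b vb]]; apply/asboolP.
  by exists [ffun=> 0]; rewrite big1 // => i _; rewrite ffunE mulr0z.
exists [ffun i => a i - b i]; rewrite {}ua {}vb -sumrB.
by apply: eq_bigr => i _; rewrite ffunE mulrzBr.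
Qed.

HB.instance Definition _ (V : zmodType) (s : seq V) :=
  GRing.isZmodClosed.Build V (span_pred s) (span_zmod_closed s).

Definition presented_group (V : zmodType) (relators : seq V) : zmodType :=
  {ideal_quot (span_pred relators : zmodClosed V)}.

Section ReducedColorings.
Variable D : diagram.

Definition arc_type : finType := {a : {set dart D} | a \in arcs D}.

Definition crossing_relator (X : {set dart D}) : {ffun arc_type -> int} :=
  [ffun a => crossing_coef X (val a)].

Definition arc_generator (b : {set dart D}) : {ffun arc_type -> int} :=
  [ffun a => if val a == b then 1 else 0].

(* Col(D) modulo trivial colorings, presented by coloring [b] with 0.         *)
Definition Colred (b : {set dart D}) : zmodType :=
  presented_group (arc_generator b
                     :: [seq crossing_relator X | X <- enum (crossings D)]).

End ReducedColorings.

(* G is isomorphic to the direct sum of the Z/n for n in ns, the isomorphism  *)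
(* being given by its coordinates; recall that 'Z_n is Z/n only if n > 1.     *)
Definition invariant_factors (G : zmodType) (ns : seq nat) : Prop :=
  [/\ all (fun n => (1 < n)%N) ns,
      sorted (fun n n' => (n' %| n)%N) ns &
      exists f : forall i : 'I_(size ns), G -> 'Z_(nth 0%N ns i),
        [/\ forall i x y, f i (x + y) = f i x + f i y,
            forall x, (forall i, f i x = 0) -> x = 0 &
            forall y : (forall i : 'I_(size ns), 'Z_(nth 0%N ns i)),
              exists x, forall i, f i x = y i]].

Definition largest_invariant_factor (G : zmodType) (n : nat) : Prop :=
  exists ns : seq nat, invariant_factors G (n :: ns).

Section Moves.
Variables D D' : diagram.

Definition isomorphic : Prop :=
  exists f : dart D' -> dart D,
    [/\ bijective f,
        forall d, opp (f d) = f (opp d),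
        forall d, ccw (f d) = f (ccw d) &
        forall d, at_crossing d -> over (f d) = over d].

(* [f] embeds the darts of D' as the darts of D outside [S], with the same    *)
(* crossing information.                                                      *)
Definition keeps_outside (S : {set dart D}) (f : dart D' -> dart D) : Prop :=
  [/\ injective f,
      forall d, (d \in codom f) = (d \notin S) &
      forall d, at_crossing d -> over (f d) = over d].

(* Erasing a bead (which must not be the only one of a circle).               *)
Definition bead_move : Prop :=
  exists (x : dart D) (f : dart D' -> dart D),
    [/\ at_bead x, opp x != ccw x,
        keeps_outside [set x; ccw x] f,
        forall d, f (ccw d) = ccw (f d) &
        forall d, f (opp d) =
          if opp (f d) == x then opp (ccw x)
          else if opp (f d) == ccw x then opp x
          else opp (f d)].

(* First Reidemeister move: the crossing of a monogon becomes a bead.         *)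
Definition R1_move : Prop :=
  exists (x : dart D) (f : dart D' -> dart D),
    [/\ at_crossing x, opp x = ccw x,
        keeps_outside [set x; ccw x] f,
        forall d, f (opp d) = opp (f d) &
        forall d, f (ccw d) =
          if f d == ccw2 x then ccw3 x
          else if f d == ccw3 x then ccw2 x
          else ccw (f d)].

(* Second Reidemeister move: the bigon has corners [x, ccw x] and [y, ccw y]; *)
(* its side [x, ccw y] is on the same strand level at both crossings. Each of *)
(* the two strands keeps one bead.                                            *)
Definition R2_move : Prop :=
  exists (x y : dart D) (f : dart D' -> dart D),
    [/\ [/\ at_crossing x, at_crossing y, y \notin porbit ccw x &
            over x = over (ccw y)],
        opp x = ccw y /\ opp (ccw x) = y,
        keeps_outside [set x; ccw x; y; ccw y] f,
        forall d, f (opp d) = opp (f d) &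
        forall d, f (ccw d) =
          if f d == ccw2 x then ccw3 y
          else if f d == ccw3 y then ccw2 x
          else if f d == ccw3 x then ccw2 y
          else if f d == ccw2 y then ccw3 x
          else ccw (f d)].

(* Third Reidemeister move: the triangle has corners [x, ccw x], [y, ccw y],  *)
(* [z, ccw z], and the strand through its side [ccw x, y] is above the other  *)
(* two. After the move each strand meets the other two in the opposite order, *)
(* which amounts to exchanging the four darts of each strand as follows.      *)
Definition R3_swap (x y z : dart D) : {perm dart D} :=
  (tperm x (ccw3 z) * tperm (ccw2 x) (ccw z)
   * tperm y (ccw3 x) * tperm (ccw2 y) (ccw x)
   * tperm z (ccw3 y) * tperm (ccw2 z) (ccw y))%g.

Definition R3_move : Prop :=
  exists (x y z : dart D) (f : dart D' -> dart D),
    [/\ [/\ at_crossing x, at_crossing y & at_crossing z],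
        [/\ y \notin porbit ccw x, z \notin porbit ccw x & z \notin porbit ccw y],
        [/\ opp (ccw x) = y, opp (ccw y) = z & opp (ccw z) = x],
        over (ccw x) && over y &
        [/\ bijective f,
            forall d, f (ccw d) = ccw (f d),
            forall d, at_crossing d -> over (f d) = over d &
            forall d, f (opp d) =
              R3_swap x y z (opp (R3_swap x y z (f d)))]].

Definition reidemeister : Prop :=
  [\/ isomorphic, bead_move, R1_move | R2_move \/ R3_move].

End Moves.

(* Links are represented by diagrams up to Reidemeister moves.                *)
Definition same_link : diagram -> diagram -> Prop :=
  clos_refl_sym_trans diagram reidemeister.

Definition trivial_link (D : diagram) : Prop :=
  exists2 D', same_link D D' & crossings D' = set0.

Definition trivial_knot (D : diagram) : Prop :=
  exists2 D', same_link D D' & crossings D' = set0 /\ components D' = 1%N.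

Definition split_link (D : diagram) : Prop :=
  exists2 D', same_link D D' & (1 < components D')%N.

(* D is obtained from D1 and D2 by cutting the edges of [d1] and [d2] and     *)
(* joining the ends.                                                          *)
Definition connected_sum (D1 D2 D : diagram) : Prop :=
  exists (d1 : dart D1) (d2 : dart D2) (g : dart D1 + dart D2 -> dart D),
    [/\ bijective g,
        (forall u, ccw (g (inl u)) = g (inl (ccw u))) /\
        (forall v, ccw (g (inr v)) = g (inr (ccw v))),
        (forall u, at_crossing u -> over (g (inl u)) = over u) /\
        (forall v, at_crossing v -> over (g (inr v)) = over v),
        opp (g (inl d1)) = g (inr d2) /\
        opp (g (inl (opp d1))) = g (inr (opp d2)) &
        (forall u, u \notin [set d1; opp d1] ->
                   opp (g (inl u)) = g (inl (opp u))) /\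
        (forall v, v \notin [set d2; opp d2] ->
                   opp (g (inr v)) = g (inr (opp v)))].

Definition prime_link (D : diagram) : Prop :=
  [/\ ~ trivial_link D,
      ~ split_link D &
      forall D1 D2 D', same_link D D' -> connected_sum D1 D2 D' ->
        trivial_knot D1 \/ trivial_knot D2].

(* The color given to the i-th arc by the k-th column of L, the last arc      *)
(* (base arc) being colored 0.                                                *)
Definition color m (L : 'M[int]_m) (i : 'I_m.+1) (k : 'I_m) : int :=
  if unlift ord_max i is Some i' then L i' k else 0.

(* Main.v *)
Require Import Defs.
From Stdlib Require Import Relation_Operators.
From mathcomp Require Import all_boot all_order all_algebra fingroup perm.
From mathcomp Require Import ring_quotient boolp ring lra zify.
(* [opp] denotes the involution of a diagram again. *)
Require Import Defs.

(** In an alternating diagram every edge has one over-end and one under-end;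
orient it from the former to the latter. Each vertex of the resulting 4-valent
graph has two outgoing and two incoming edges. Moreover each arc is the over-arc
of exactly one crossing and ends at the heads of the two edges that leave this
crossing, so that the crossing matrix acts on row vectors, seen as functions on
vertices, as a Laplacian: [(v C')_k = 2 v_k - v_p - v_q], where [p] and [q] are
the heads of the edges that leave [k] ([mul_crossing_matrix]).

The diagram is connected because the link is not split. As in-degrees equal
out-degrees, the maximum principle shows that only constants are harmonic
([harmonic_constant]), whence the reduced matrix [C] is invertible
([reduced_crossing_matrix_unit]); [n1 C^-1] is integral because [n1] annihilates
the group presented by [C] ([reduced_crossing_matrix_left_inverse]).

If no column distinguishes the arcs [a_i] and [a_j], the difference of the rows
[i] and [j] of [C^-1] is integral: this is an integral function on vertices
whose Laplacian is 1 at [i], -1 at [j] and 0 elsewhere. Consider the set of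
vertices where it is maximal. Edges that leave this set start at [i], and there
is only one of them since the values drop by a total of 1; by balance only one
edge enters the set ([cut_of_potential]). Cutting these two edges presents the
diagram as a connected sum of two smaller ones ([connected_sum_parts]). These
are planar: [over] is constant along the faces of an alternating diagram, so
that the two sides of an edge lie in different faces, the faces can be counted
([cut_faces]), and Euler's inequality leaves no room for a handle.

The link being prime, one of the two summands is a diagram of the trivial knot.
Colorings by an arbitrary abelian group are transported by Reidemeister moves
([colorless_same_link]), so all the colorings of this summand are constant. For
the universal coloring, this means that the difference of any two generators is
an integral combination of relators ([colorless_potential]), and the level-set
argument now separates any two vertices of the summand by a cut of two edges.
Uncrossing these cuts produces a loop other than the edge created by the
decomposition ([colorless_loop]). It is a loop of the given diagram, and the
crossing which carries it is nugatory ([part_not_colorless]): the diagram was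
not reduced. *)

Set Implicit Arguments.
Unset Strict Implicit.
Unset Printing Implicit Defensive.

Import Order.TTheory GRing.Theory Num.Theory.
Local Open Scope ring_scope.

(** * Orbits of permutations *)

Section Orbits.
Variable T : finType.
Implicit Types (s t : {perm T}) (x y z : T).

Lemma mem_porbit1 s x : s x \in porbit s x.
Proof. exact: (mem_porbit s 1). Qed.

Lemma porbit_step s x : porbit s (s x) = porbit s x.
Proof. exact: (porbit_perm s 1). Qed.

Lemma porbit_closed s (A : {pred T}) x y :
  (forall z, z \in A -> s z \in A) -> x \in A -> y \in porbit s x -> y \in A.
Proof.
move=> sA xA /porbitP[i ->]; elim: i => [|i IHi]; first by rewrite perm1.
by rewrite expgSr permM; apply: sA.
Qed.

Lemma porbit_const (U : Type) s (f : T -> U) x y :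
  (forall z, f (s z) = f z) -> y \in porbit s x -> f y = f x.
Proof.
move=> fs /porbitP[i ->]; elim: i => [|i IHi]; first by rewrite perm1.
by rewrite expgSr permM fs.
Qed.

Lemma porbits_disjoint_merge s x y : x \notin porbit s y ->
  #|porbits (tperm x y * s)%g|.+1 = #|porbits s|.
Proof.
move=> xy; have /= := porbits_mul_tperm s x y.
rewrite xy (_ : x != y); first by rewrite addn2 addn1 => -[].
by apply: contraNneq xy => ->; apply: porbit_id.
Qed.

Lemma porbits_tperm_le s x y :
  (#|porbits (tperm x y * s)%g| <= #|porbits s|.+1)%N.
Proof.
have /= := porbits_mul_tperm s x y => E.
apply: (@leq_trans (#|porbits s| + (x != y))); first by rewrite -E leq_addr.
by rewrite -addn1 leq_add2l; case: (x != y).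
Qed.

(** When [x] and [y] lie in distinct orbits of [s], the orbits of
[tperm x y * s] contain those of [s]: counting orbits twice shows that [x] and
[y] have been brought together. *)
Lemma porbit_merge s x y : x \notin porbit s y ->
  x \in porbit (tperm x y * s)%g y /\
  forall z, s z \in porbit (tperm x y * s)%g z.
Proof.
move=> xy; set s' := (tperm x y * s)%g.
have nxy : x != y by apply: contraNneq xy => ->; apply: porbit_id.
have s'xy : x \in porbit s' y.
  have /= := porbits_mul_tperm s' x y.
  rewrite /s' mulgA tperm2 mul1g -/s' -(porbits_disjoint_merge xy) -/s' nxy.
  by rewrite addn1 -{2}[_.+1]addn0 => /addnI; case: (x \in _).
split=> // z; rewrite -eq_porbit_mem.
have [->|nzx] := eqVneq z x.
  have -> : s x = s' y by rewrite permM tpermR.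
  by rewrite porbit_step eq_sym eq_porbit_mem.
have [->|nzy] := eqVneq z y.
  have -> : s y = s' x by rewrite permM tpermL.
  by rewrite porbit_step eq_porbit_mem.
have -> : s z = s' z by rewrite permM tpermD // eq_sym.
by rewrite porbit_step.
Qed.

Lemma linked_connect_sym s t : connect_sym (linked s t).
Proof.
have back (u : {perm T}) x :
      (forall y, linked s t y (u y)) -> connect (linked s t) (u x) x.
  move=> lu; have /porbitP[i {2}->] : x \in porbit u (u x).
    by rewrite porbit_sym mem_porbit1.
  elim: i => [|i IHi]; first by rewrite perm1 connect0.
  by rewrite expgSr permM; apply: connect_trans IHi _; apply: connect1.
have imp x y : connect (linked s t) x y -> connect (linked s t) y x.
  move=> /connectP[p + ->]; elim: p x => [|z p IHp] x /=.
    by rewrite connect0.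
  case/andP=> xz /IHp zy; apply: connect_trans zy _.
  by case/orP: xz => /eqP ->; apply: back => w; rewrite /linked /= eqxx ?orbT.
by move=> x y; apply/idP/idP; apply: imp.
Qed.

Lemma linked_closed s t (A : {pred T}) x y :
    (forall z, z \in A -> s z \in A) -> (forall z, z \in A -> t z \in A) ->
  connect (linked s t) x y -> x \in A -> y \in A.
Proof.
move=> sA tA /connectP[p + ->].
elim: p x => [|z p IHp] x //= /andP[xz /IHp zA] xA.
by apply: zA; case/orP: xz => /eqP ->; [apply: sA | apply: tA].
Qed.

(** An involution [t] is split into the transposition of [a] and [t a] and an
involution that fixes both. *)
Lemma involution_tperm t a : (forall d, t (t d) = d) ->
  let t' := (t * tperm a (t a))%g in
  [/\ forall d, t' (t' d) = d, t = (t' * tperm a (t a))%g,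
      t' a = a, t' (t a) = t a &
      forall d, t' d != d -> [/\ t d != d, d != a & d != t a]].
Proof.
move=> tt t'; have t'a : t' a = a by rewrite permM tpermR.
have t'ta : t' (t a) = t a by rewrite permM tt tpermL.
have t'D d : d != a -> d != t a -> t' d = t d.
  move=> da dta; rewrite permM tpermD //.
    by rewrite eq_sym (can2_eq tt tt).
  by rewrite (inj_eq perm_inj) eq_sym.
split=> //.
- move=> d; have [->|da] := eqVneq d a; first by rewrite !t'a.
  have [->|dta] := eqVneq d (t a); first by rewrite !t'ta.
  rewrite (t'D d) // t'D ?tt //; first by rewrite (can2_eq tt tt).
  by rewrite (inj_eq perm_inj).
- by rewrite /t' -mulgA tperm2 mulg1.
move=> d t'd; have da : d != a by apply: contraNneq t'd => ->; rewrite t'a.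
have dta : d != t a by apply: contraNneq t'd => ->; rewrite t'ta.
by split=> //; rewrite -t'D.
Qed.

(** The support of a permutation. *)
Definition moved t : {set T} := [set d | t d != d].

Lemma moved_involution_tperm t a : (forall d, t (t d) = d) -> t a != a ->
  (#|moved (t * tperm a (t a))%g|.+2 <= #|moved t|)%N.
Proof.
move=> tt ta; have [_ _ _ _ mv] := involution_tperm a tt.
rewrite (cardsD1 a (moved t)) (cardsD1 (t a) (_ :\ a)) !inE ta tt (eq_sym a) ta.
rewrite !add1n !ltnS; apply/subset_leq_card/subsetP=> d.
by rewrite !inE => /mv[-> -> ->].
Qed.

Lemma porbits_involution_le s t : (forall d, t (t d) = d) ->
  ((#|porbits (t * s)%g|).*2 <= #|porbits s|.*2 + #|moved t|)%N.
Proof.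
have [n] := ubnP #|moved t|; elim: n t s => // n IHn t s le_n tt.
have [/eqP m0|[a]] := set_0Vmem (moved t).
  rewrite (_ : t = 1%g) ?mul1g ?leq_addr //.
  apply/permP=> d; rewrite perm1; apply/eqP/negbNE.
  by move: m0 => /eqP/setP/(_ d); rewrite !inE => ->.
rewrite inE => ta; have [t't' tE _ _ _] := involution_tperm a tt.
have le := moved_involution_tperm tt ta.
move: t't' tE le; set t' := (t * tperm a (t a))%g => t't' tE le.
rewrite {1}tE -mulgA.
apply: leq_trans (IHn t' (tperm a (t a) * s)%g _ t't') _.
  by apply: leq_trans (ltnW le) _; rewrite -ltnS.
apply: leq_trans _ (leq_add (leqnn _) le).
rewrite addnS addnS -!addSn leq_add2r -doubleS leq_double.
exact: porbits_tperm_le.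
Qed.

(** Euler's inequality for a connected map: its genus is nonnegative. The orbits
of [s], [t] and [t * s] are the vertices, edges and faces. Edges joining
distinct orbits of [s] are absorbed first, each one decreasing the number of
orbits; once a single orbit is left, each of the remaining edges creates at most
one new orbit. *)
Lemma euler_inequality s t : (forall d, t (t d) = d) ->
  (forall x y, connect (linked s t) x y) ->
  ((#|porbits (t * s)%g| + #|porbits s|).*2 <= #|moved t| + 4)%N.
Proof.
have [n] := ubnP #|moved t|; elim: n t s => // n IHn t s le_n tt conn.
have [/existsP[a a_sep]|/existsPn all_in] :=
  boolP [exists a, a \notin porbit s (t a)].
  have ta : t a != a by apply: contraNneq a_sep => ->; apply: porbit_id.
  have [t't' tE t'a t'ta _] := involution_tperm a tt.
  have le := moved_involution_tperm tt ta.
  have [mxy mz] := porbit_merge a_sep.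
  have cardE := porbits_disjoint_merge a_sep.
  move: t't' tE le t'a t'ta mxy mz cardE.
  set t' := (t * tperm a (t a))%g => t't' tE le t'a t'ta.
  set s' := (tperm a (t a) * s)%g => mxy mz cardE.
  have po_conn x y : y \in porbit s' x -> connect (linked s' t') x y.
    move=> /porbitP[i ->]; elim: i => [|i IHi]; first by rewrite perm1 connect0.
    rewrite expgSr permM; apply: connect_trans IHi _; apply: connect1.
    by rewrite /linked /= eqxx.
  have -> : (t * s)%g = (t' * s')%g by rewrite {1}tE -mulgA.
  rewrite -cardE addnS doubleS.
  apply: (@leq_trans (#|moved t'|.+2 + 4)); last by rewrite leq_add2r.
  rewrite !addSn !ltnS; apply: IHn => //.
    by apply: leq_trans (ltnW le) _; rewrite -ltnS.
  have sub : subrel (linked s t) (connect (linked s' t')).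
    move=> z w /orP[] /eqP ->; first exact: po_conn.
    have [->|za] := eqVneq z a; first by apply: po_conn; rewrite porbit_sym.
    have [->|zta] := eqVneq z (t a); first by rewrite tt; apply: po_conn.
    apply: connect1; apply/orP; right; apply/eqP; rewrite tE permM tpermD //.
      by rewrite -t'a (inj_eq perm_inj) eq_sym.
    by rewrite -t'ta (inj_eq perm_inj) eq_sym.
  by move=> x y; exact: (connect_sub sub) (conn x y).
have one : (#|porbits s| <= 1)%N.
  apply/card_le1_eqP => _ _ /imsetP[x _ ->] /imsetP[y _ ->].
  suff : y \in porbit s x by rewrite -eq_porbit_mem => /eqP ->.
  apply: (@linked_closed s t (porbit s x) x y _ _ (conn x y));
    last exact: porbit_id.
    by move=> z zx; rewrite -eq_porbit_mem porbit_step eq_porbit_mem.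
  move=> z; rewrite -!eq_porbit_mem => /eqP <-; rewrite eq_porbit_mem.
  by rewrite porbit_sym; have := all_in z; rewrite negbK.
rewrite doubleD; have /= := porbits_involution_le s tt.
move: one; case: #|porbits s| => [|[|//]] _ /=; rewrite ?addn0 ?add0n.
  by move=> le; apply: leq_trans le _; rewrite leq_addr.
by move=> le; rewrite (_ : 4 = 2 + 2)%N // addnA leq_add2r addnC.
Qed.

Lemma n_comp1P s t (x0 : T) :
  reflect (forall x y, connect (linked s t) x y)
          (n_comp (linked s t) predT <= 1)%N.
Proof.
have sym := @linked_connect_sym s t; apply: (iffP idP).
  move=> /card_le1_eqP uniq x y; apply/(fingraph.rootP sym).
  by apply: uniq; rewrite !inE andbT roots_root.
move=> conn; rewrite -(n_comp_connect sym x0) leq_eqVlt; apply/orP; left.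
by apply/eqP; apply: eq_n_comp_r => x; rewrite !inE [RHS]conn.
Qed.

Lemma n_comp_gt0 s t (x0 : T) : (0 < n_comp (linked s t) predT)%N.
Proof.
apply/card_gt0P; exists (fingraph.root (linked s t) x0).
by rewrite !inE andbT roots_root //; apply: linked_connect_sym.
Qed.

Lemma porbits_fixfree_involution t :
  (forall d, t (t d) = d) -> (forall d, t d != d) -> #|porbits t|.*2 = #|T|.
Proof.
move=> tt tn; rewrite -mul2n mulnC -cardsT; symmetry.
apply: card_uniform_partition; last first.
  have -> : porbits t =
      equivalence_partition (fun x y => y \in porbit t x) [set: T].
    apply/setP=> A; apply/imsetP/imsetP => -[x _ ->]; exists x => //.
      by apply/setP=> y; rewrite !inE.
    by apply/setP=> y; rewrite !inE.
  apply: equivalence_partitionP => x y z _ _ _; split; first exact: porbit_id.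
  by rewrite -eq_porbit_mem => /eqP ->.
move=> _ /imsetP[x _ ->]; have -> : porbit t x = [set x; t x].
  apply/setP=> y; apply/idP/idP; last first.
    by rewrite !inE => /orP[] /eqP ->; rewrite ?porbit_id ?mem_porbit1.
  apply: (@porbit_closed _ [set x; t x]); last by rewrite !inE eqxx.
  by move=> z; rewrite !inE => /orP[] /eqP ->; rewrite ?tt eqxx ?orbT.
by rewrite cards2 eq_sym tn.
Qed.

End Orbits.

(** Orbits of a permutation that respects a splitting of its domain. *)
Lemma card_porbits_sum (T1 T2 T : finType) (g : T1 + T2 -> T)
    (s1 : {perm T1}) (s2 : {perm T2}) (s : {perm T}) : bijective g ->
    (forall u, s (g (inl u)) = g (inl (s1 u))) ->
    (forall v, s (g (inr v)) = g (inr (s2 v))) ->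
  #|porbits s| = (#|porbits s1| + #|porbits s2|)%N.
Proof.
move=> [h gK hK] g1 g2; have g_inj := can_inj gK.
have p1 i u : (s ^+ i)%g (g (inl u)) = g (inl ((s1 ^+ i)%g u)).
  by elim: i => [|i IHi]; rewrite ?perm1 // !expgSr !permM IHi g1.
have p2 i u : (s ^+ i)%g (g (inr u)) = g (inr ((s2 ^+ i)%g u)).
  by elim: i => [|i IHi]; rewrite ?perm1 // !expgSr !permM IHi g2.
pose i1 (A : {set T1}) := [set g (inl x) | x in A].
pose i2 (A : {set T2}) := [set g (inr x) | x in A].
have i1_inj : injective i1 by apply: imset_inj => x y /g_inj[].
have i2_inj : injective i2 by apply: imset_inj => x y /g_inj[].
have e1 u : porbit s (g (inl u)) = i1 (porbit s1 u).
  apply/setP=> d; apply/porbitP/imsetP => [[i ->]|[_ /porbitP[i ->] ->]].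
    by exists ((s1 ^+ i)%g u); rewrite ?mem_porbit.
  by exists i; rewrite p1.
have e2 u : porbit s (g (inr u)) = i2 (porbit s2 u).
  apply/setP=> d; apply/porbitP/imsetP => [[i ->]|[_ /porbitP[i ->] ->]].
    by exists ((s2 ^+ i)%g u); rewrite ?mem_porbit.
  by exists i; rewrite p2.
have -> : porbits s = i1 @: porbits s1 :|: i2 @: porbits s2.
  apply/setP=> A; rewrite inE; apply/imsetP/orP.
    case=> d _ ->; rewrite -[d]hK; case: (h d) => u.
      by left; rewrite e1 !imset_f.
    by right; rewrite e2 !imset_f.
  by case=> /imsetP[_ /imsetP[x _ ->] ->];
    [exists (g (inl x)) | exists (g (inr x))].
rewrite cardsU (card_imset _ i1_inj) (card_imset _ i2_inj).
rewrite (_ : _ :&: _ = set0) ?cards0 ?subn0 //.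
apply/setP=> A; rewrite !inE; apply/negP.
move=> /andP[/imsetP[_ /imsetP[x _ ->] ->]].
case/imsetP=> _ /imsetP[y _ ->] E.
have : g (inl x) \in i2 (porbit s2 y) by rewrite -E imset_f ?porbit_id.
by case/imsetP=> z _ /g_inj.
Qed.

(** * Vertices of a diagram *)

Section Vertices.
Variable D : diagram.
Implicit Types (d e x y : dart D).

Lemma ccw4 d : ccw (ccw3 d) = d. Proof. exact: ccw_order. Qed.

Lemma ccw2K : involutive (@ccw2 D).
Proof. by move=> d; apply: ccw_order. Qed.

Lemma opp_eq d e : (opp d == e) = (d == opp e).
Proof. by apply/eqP/eqP => [<-|->]; rewrite opp_inv. Qed.

Lemma at_crossing_ccw d : at_crossing (ccw d) = at_crossing d.
Proof. by rewrite /at_crossing /ccw2 (inj_eq perm_inj). Qed.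

Lemma at_beadN d : at_bead d = ~~ at_crossing d.
Proof. by rewrite /at_crossing negbK. Qed.

Lemma bead_crossingF d : at_bead d -> at_crossing d = false.
Proof. by rewrite at_beadN => /negbTE. Qed.

Lemma over_ccw d : at_crossing d -> over (ccw d) = ~~ over d.
Proof. exact: over_alt. Qed.

Lemma over_ccw2 d : at_crossing d -> over (ccw2 d) = over d.
Proof.
by move=> Xd; rewrite /ccw2 over_ccw ?at_crossing_ccw // over_ccw // negbK.
Qed.

Lemma over_ccw3 d : at_crossing d -> over (ccw3 d) = ~~ over d.
Proof.
move=> Xd; rewrite /ccw3 over_ccw ?at_crossing_ccw //.
by rewrite -/(ccw2 d) over_ccw2.
Qed.

Lemma porbit_ccwE x : porbit ccw x = [set x; ccw x; ccw2 x; ccw3 x].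
Proof.
apply/setP=> d; apply/idP/idP; last first.
  have s e : e \in porbit ccw x -> ccw e \in porbit ccw x.
    by rewrite -!eq_porbit_mem porbit_step.
  have s0 := porbit_id ccw x; have s1 := s _ s0; have s2 := s _ s1.
  by rewrite !inE -!orbA; case/or4P=> /eqP -> //; apply: s.
apply: (@porbit_closed _ _ [set x; ccw x; ccw2 x; ccw3 x]);
  last by rewrite !inE eqxx.
move=> z; rewrite !inE -!orbA.
by case/or4P=> /eqP ->; rewrite ?ccw4 eqxx ?orbT.
Qed.

Lemma ccw_neqs x : at_crossing x ->
  [/\ (ccw x == x) = false, (ccw2 x == x) = false & (ccw3 x == x) = false] /\
  [/\ (ccw2 x == ccw x) = false, (ccw3 x == ccw x) = false
    & (ccw3 x == ccw2 x) = false].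
Proof.
move=> Xx; have c1 : (ccw x == x) = false by apply/negbTE/ccw_neq.
have c2 : (ccw2 x == x) = false by apply/negbTE.
have c3 : (ccw3 x == x) = false.
  apply/negP => /eqP E; have := ccw4 x; rewrite E => /eqP; by rewrite c1.
by rewrite /ccw3 /ccw2 !(inj_eq perm_inj) -/(ccw2 x) !(c1, c2, c3).
Qed.

End Vertices.

(** * Fox colorings *)

(** The condition that a Fox coloring by an abelian group, seen as a function on
darts, satisfies around the vertex of [d]: strands go through beads and through
over-crossings with the same color, and the colors of the two under-strands of a
crossing are symmetric with respect to that of the over-strand. At a crossing it
is stated from the over-darts only. *)
Definition vertex_rule (D : diagram) (M : zmodType) (t : dart D -> M) d :
    Prop :=
  (at_bead d -> t (ccw d) = t d) /\
  (at_crossing d -> over d ->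
     t (ccw2 d) = t d /\ t (ccw d) + t (ccw3 d) = t d + t d).

(** Fox colorings; being functions on darts, they make sense on diagrams with
beads, where arcs need not contain an over-dart. *)
Definition coloring (D : diagram) (M : zmodType) (t : dart D -> M) : Prop :=
  (forall d, t (opp d) = t d) /\ (forall d, vertex_rule t d).

(** All Fox colorings, by whatever abelian group, are trivial, that is,
constant. *)
Definition colorless (D : diagram) : Prop :=
  forall (M : zmodType) (t : dart D -> M), coloring t -> forall d e, t d = t e.

Section ColoringTheory.
Variables (D : diagram) (M : zmodType).
Implicit Types (d e x y : dart D) (t : dart D -> M).

Lemma coloring_over t x : coloring t -> at_crossing x -> over x ->
  t (ccw2 x) = t x /\ t (ccw x) + t (ccw3 x) = t x + t x.
Proof. by move=> [_ /(_ x)[_ Px]] Xx ox; apply: Px. Qed.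

Lemma coloring_under t x : coloring t -> at_crossing x -> ~~ over x ->
  t (ccw3 x) = t (ccw x) /\ t x + t (ccw2 x) = t (ccw x) + t (ccw x).
Proof.
move=> [_ /(_ (ccw x))[_]]; rewrite at_crossing_ccw => Px Xx ox.
have [|E1 E2] := Px Xx; first by rewrite over_ccw.
by split=> //; rewrite addrC -E2 /ccw3 ccw_order.
Qed.

Lemma vertex_rule_over t x : at_crossing x -> over x ->
  t (ccw2 x) = t x -> t (ccw x) + t (ccw3 x) = t x + t x ->
  forall d, d \in porbit ccw x -> vertex_rule t d.
Proof.
move=> Xx ox E1 E2 d; rewrite porbit_ccwE !inE -!orbA => d_x.
have Xd : at_crossing d.
  by case/or4P: d_x => /eqP ->; rewrite /ccw3 /ccw2 ?at_crossing_ccw.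
split; first by rewrite at_beadN Xd.
move=> _; case/or4P: d_x => /eqP ->;
  rewrite ?over_ccw3 ?over_ccw2 ?over_ccw ?ox //.
by move=> _; rewrite /ccw3 /ccw2 !ccw_order -/(ccw2 x) -/(ccw3 x) E1 addrC.
Qed.

Lemma vertex_rule_under t x : at_crossing x -> ~~ over x ->
  t (ccw3 x) = t (ccw x) -> t x + t (ccw2 x) = t (ccw x) + t (ccw x) ->
  forall d, d \in porbit ccw x -> vertex_rule t d.
Proof.
move=> Xx ox E1 E2 d; rewrite -porbit_step; apply: vertex_rule_over => //.
- by rewrite at_crossing_ccw.
- by rewrite over_ccw.
by rewrite addrC -E2 /ccw3 ccw_order.
Qed.

End ColoringTheory.

(** [f] identifies the darts of [D'] with those of [D] outside [S]; the vertices
of [D] outside [U] are also vertices of [D']. *)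
Section Transfer.
Variables (D D' : diagram) (S U : {set dart D}) (f : dart D' -> dart D).
Hypothesis f_keeps : keeps_outside S f.
Hypothesis U_closed : forall d, d \in U -> ccw d \in U.
Hypothesis f_ccw : forall u, f u \notin U -> f (ccw u) = ccw (f u).

Let f_inj : injective f. Proof. by case: f_keeps. Qed.

Lemma keeps_outside_pre d : d \notin S -> exists u, d = f u.
Proof. by case: f_keeps => _ <- _ /codomP[u ->]; exists u. Qed.

Lemma keeps_outsideN u : f u \notin S.
Proof. by case: f_keeps => _ <- _; apply: codom_f. Qed.

Lemma extend_outside (M : Type) (t' : dart D' -> M) (h : dart D -> M) :
  exists t : dart D -> M,
    (forall u, t (f u) = t' u) /\ (forall d, d \in S -> t d = h d).
Proof.
exists (fun d => if [pick u | f u == d] is Some u then t' u else h d).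
split=> [u|d dS]; case: pickP => [v /eqP E|].
- by rewrite (f_inj E).
- by move/(_ u); rewrite eqxx.
- by have := keeps_outsideN v; rewrite E dS.
- by [].
Qed.

Lemma unchanged_ccw u : f u \notin U ->
  [/\ f (ccw u) = ccw (f u), f (ccw2 u) = ccw2 (f u) & f (ccw3 u) = ccw3 (f u)].
Proof.
have UN d : d \notin U -> ccw d \notin U.
  by apply: contra => cd; rewrite -(ccw_order d); do 3!apply: U_closed.
move=> uU; have E1 := f_ccw uU.
have E2 : f (ccw2 u) = ccw2 (f u) by rewrite /ccw2 f_ccw E1 // UN.
by split=> //; rewrite /ccw3 f_ccw -/(ccw2 u) E2 // !UN.
Qed.

Lemma unchanged_vertex_rule (M : zmodType) (t : dart D -> M) u :
  f u \notin U -> (vertex_rule (t \o f) u <-> vertex_rule t (f u)).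
Proof.
move=> uU; have [E1 E2 E3] := unchanged_ccw uU.
have XE : at_crossing (f u) = at_crossing u.
  by rewrite /at_crossing -E2 (inj_eq f_inj).
rewrite /vertex_rule /= !at_beadN XE E1 E2 E3.
have [_ _ oE] := f_keeps; have [Xu|//] := boolP (at_crossing u).
  by rewrite oE.
by split=> -[P Q]; split.
Qed.

(** A local modification preserves colorlessness as soon as each coloring of one
diagram induces one of the other, the colors of the removed darts being
determined by the remaining ones at least for constant colorings. *)
Lemma colorless_transfer :
    S \subset U ->
    (forall (M : zmodType) (t : dart D -> M), coloring t ->
      [/\ forall u, t (f (opp u)) = t (f u),
          forall u, f u \in U -> vertex_rule (t \o f) u &
          forall a, (forall u, t (f u) = a) -> forall d, d \in S -> t d = a]) ->
    (forall (M : zmodType) (t' : dart D' -> M), coloring t' ->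
      exists h : dart D -> M, forall t : dart D -> M,
        (forall u, t (f u) = t' u) -> (forall d, d \in S -> t d = h d) ->
        (forall d, t (opp d) = t d) /\
        (forall d, d \in U -> vertex_rule t d)) ->
  colorless D <-> colorless D'.
Proof.
move=> SU down up; split=> triv M t tc.
  have [h ht] := up M t tc; have [t0 [t0f t0S]] := extend_outside t h.
  have [o v] := ht t0 t0f t0S.
  suff t0c : coloring t0 by move=> d e; rewrite -!t0f; apply: triv.
  split=> // d; have [/v//|dU] := boolP (d \in U).
  have dS : d \notin S by apply: contra dU; apply: (subsetP SU).
  have [u E] := keeps_outside_pre dS; rewrite E in dU *.
  apply/unchanged_vertex_rule => //.
  have [P Q] := tc.2 u; rewrite /vertex_rule /= !t0f; split=> //.
have [o v S_const] := down M t tc.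
have t0c : coloring (t \o f).
  split=> // u; have [/v//|uU] := boolP (f u \in U).
  by apply/unchanged_vertex_rule => //; apply: tc.2.
have all_const d e : d \notin S -> t e = t d.
  move=> /keeps_outside_pre[u ->].
  have const_u v' : t (f v') = t (f u) by apply: (triv M _ t0c).
  have [eS|/keeps_outside_pre[w ->]] := boolP (e \in S); last exact: const_u.
  exact: S_const const_u _ eS.
have [[d0 d0S]|noS] := pselect (exists d, d \notin S).
  by move=> d e; rewrite (all_const d0 d) // (all_const d0 e).
have inS d : d \in S by apply/negPn/negP => dS; apply: noS; exists d.
have ftriv a u : t (f u) = a by have := keeps_outsideN u; rewrite inS.
by move=> d e; rewrite (S_const (t e) _ d).
Qed.

End Transfer.

(** * Invariance under Reidemeister moves *)

Lemma colorless_isomorphic (D D' : diagram) :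
  isomorphic D D' -> (colorless D <-> colorless D').
Proof.
move=> [f [[g fK gK] f_opp f_ccw f_over]].
apply: (@colorless_transfer D D' set0 set0 f) => //.
- split; [exact: can_inj fK | | exact: f_over] => d.
  by rewrite inE; apply/codomP; exists (g d); rewrite gK.
- by move=> d; rewrite inE.
- move=> M t [t_opp _]; split=> [u|u|a _ d]; rewrite ?inE //.
  by rewrite -f_opp t_opp.
move=> M t' [t'_opp _]; exists (fun=> 0) => t tf _.
split=> d; last by rewrite inE.
by rewrite -[d]gK f_opp !tf t'_opp.
Qed.

Lemma colorless_bead_move (D D' : diagram) :
  bead_move D D' -> (colorless D <-> colorless D').
Proof.
move=> [x [f [Bx oxc f_keeps f_ccw f_opp]]].
have Bx2 : ccw (ccw x) = x by apply/eqP.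
have cxx : (ccw x == x) = false by apply/negbTE/ccw_neq.
apply: (colorless_transfer (U := [set x; ccw x]) f_keeps) => //.
- by move=> d; rewrite !inE => /orP[] /eqP ->; rewrite ?Bx2 eqxx ?orbT.
- move=> M t tc; have [t_opp t_v] := tc.
  have tcx : t (ccw x) = t x by case: (t_v x) => + _; apply.
  split=> [u|u uS|a ta d].
  + rewrite f_opp -(t_opp (f u)); case: eqP => [->|_]; first by rewrite t_opp.
    by case: eqP => [->|_ //]; rewrite t_opp.
  + by have := keeps_outsideN f_keeps u; rewrite uS.
  have ox : opp x \notin [set x; ccw x] by rewrite !inE negb_or opp_neq.
  have [u oxE] := keeps_outside_pre f_keeps ox.
  have tx : t x = a by rewrite -t_opp oxE.
  by rewrite !inE => /orP[] /eqP ->; rewrite ?tcx.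
move=> M t' [t'_opp t'_v].
have ox : opp x \notin [set x; ccw x] by rewrite !inE negb_or opp_neq.
have [u oxE] := keeps_outside_pre f_keeps ox.
have ocx : opp (ccw x) \notin [set x; ccw x].
  by rewrite !inE negb_or opp_neq andbT opp_eq eq_sym.
have [v ocxE] := keeps_outside_pre f_keeps ocx.
have f_inj : injective f by case: f_keeps.
have ouv : opp u = v.
  by apply: f_inj; rewrite f_opp -oxE opp_inv eqxx ocxE.
have t'uv : t' v = t' u by rewrite -ouv t'_opp.
exists (fun=> t' u) => t tf th.
have tx : t x = t' u by apply: th; rewrite !inE eqxx.
have tcx : t (ccw x) = t' u by apply: th; rewrite !inE eqxx orbT.
have tox : t (opp x) = t' u by rewrite oxE tf.
have tocx : t (opp (ccw x)) = t' u by rewrite ocxE tf.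
split=> d.
  have [|dS] := boolP (d \in [set x; ccw x]).
    by rewrite !inE => /orP[] /eqP ->; rewrite ?tox ?tocx ?tx ?tcx.
  have [w dE] := keeps_outside_pre f_keeps dS.
  rewrite dE tf -t'_opp -(tf (opp w)) f_opp.
   case: eqP => [->|_]; first by rewrite tx tocx.
  by case: eqP => [->|_ //]; rewrite tcx tox.
rewrite !inE => /orP[] /eqP ->; split=> [_|]; rewrite ?Bx2 ?tx ?tcx //.
  by rewrite bead_crossingF.
by rewrite at_crossing_ccw bead_crossingF.
Qed.

Lemma colorless_R1_move (D D' : diagram) :
  R1_move D D' -> (colorless D <-> colorless D').
Proof.
move=> [x [f [Xx oxE f_keeps f_opp f_ccw]]].
have [[n1 n2 n3] [n4 n5 n6]] := ccw_neqs Xx.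
have f_inj : injective f by case: f_keeps.
have U_E := porbit_ccwE x; set U := porbit ccw x in U_E.
have s2 : ccw2 x \notin [set x; ccw x] by rewrite !inE n2 n4.
have s3 : ccw3 x \notin [set x; ccw x] by rewrite !inE n3 n5.
have [u2 u2E] := keeps_outside_pre f_keeps s2.
have [u3 u3E] := keeps_outside_pre f_keeps s3.
have c2 : ccw u2 = u3 by apply: f_inj; rewrite f_ccw -u2E eqxx.
have c3 : ccw u3 = u2 by apply: f_inj; rewrite f_ccw -u3E n6 eqxx.
have b2 : at_bead u2 by rewrite /at_bead /ccw2 c2 c3.
have b3 : at_bead u3 by rewrite /at_bead /ccw2 c3 c2.
have fU u : f u \in U -> u = u2 \/ u = u3.
  have := keeps_outsideN f_keeps u; rewrite U_E !inE -!orbA !negb_or.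
  case/andP=> /negbTE -> /negbTE -> /=.
  case/orP=> /eqP E; [left|right]; apply: f_inj.
    by rewrite E.
  by rewrite E.
apply: (colorless_transfer (U := U) f_keeps).
- by move=> d; rewrite /U -!eq_porbit_mem porbit_step.
- move=> u uU; rewrite f_ccw; case: eqP => [E|_].
    by case/negP: uU; rewrite E U_E !inE eqxx ?orbT.
  by case: eqP => [E|//]; case/negP: uU; rewrite E U_E !inE eqxx ?orbT.
- by apply/subsetP=> d; rewrite U_E !inE => /orP[] ->; rewrite ?orbT.
- move=> M t tc; have [t_opp t_v] := tc.
  have tcx : t (ccw x) = t x by rewrite -oxE t_opp.
  have [t2 t3] : t (ccw2 x) = t x /\ t (ccw3 x) = t x.
    have [ox|ox] := boolP (over x).
      by have [-> /eqP] := coloring_over tc Xx ox; rewrite tcx => /eqP/addrI ->.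
    by have [-> /eqP] := coloring_under tc Xx ox; rewrite tcx => /eqP/addrI ->.
  split=> [u|u|a ta d].
  + by rewrite f_opp t_opp.
  + case/fU=> ->; split; rewrite ?c2 ?c3 /= -?u2E -?u3E ?t2 ?t3 //.
      by rewrite bead_crossingF.
    by rewrite bead_crossingF.
  have tx : t x = a by rewrite -t2 u2E ta.
  by rewrite !inE => /orP[] /eqP ->; rewrite ?tcx.
move=> M t' [t'_opp t'_v]; exists (fun=> t' u2) => t tf th.
have tx : t x = t' u2 by apply: th; rewrite !inE eqxx.
have tcx : t (ccw x) = t' u2 by apply: th; rewrite !inE eqxx orbT.
have t2 : t (ccw2 x) = t' u2 by rewrite u2E tf.
have t3 : t (ccw3 x) = t' u2.
  by rewrite u3E tf -c2; case: (t'_v u2) => + _; apply.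
split=> d.
  have [|dS] := boolP (d \in [set x; ccw x]).
    rewrite !inE => /orP[] /eqP ->; first by rewrite oxE tcx tx.
    by rewrite -oxE opp_inv oxE tcx tx.
  have [w ->] := keeps_outside_pre f_keeps dS.
  by rewrite -f_opp !tf t'_opp.
have [ox|ox] := boolP (over x).
  by apply: vertex_rule_over => //; rewrite ?t2 ?t3 ?tcx ?tx.
by apply: vertex_rule_under => //; rewrite ?t2 ?t3 ?tcx ?tx.
Qed.

Lemma colorless_R2_move (D D' : diagram) :
  R2_move D D' -> (colorless D <-> colorless D').
Proof.
move=> [x [y [f [[Xx Xy xy oxy] [oxE ocxE] f_keeps f_opp f_ccw]]]].
have [[n1 n2 n3] [n4 n5 n6]] := ccw_neqs Xx.
have [[m1 m2 m3] [m4 m5 m6]] := ccw_neqs Xy.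
have f_inj : injective f by case: f_keeps.
have Ux_E := porbit_ccwE x; have Uy_E := porbit_ccwE y.
have nyx d e : d \in porbit ccw x -> e \in porbit ccw y -> (e == d) = false.
  move=> dx ey; apply: contraNF xy => /eqP E; rewrite -E in dx.
  by move: dx ey; rewrite -!eq_porbit_mem => /eqP <- /eqP ->.
have nxy d e : d \in porbit ccw x -> e \in porbit ccw y -> (d == e) = false.
  by move=> dx ey; rewrite eq_sym nyx.
have [x0 x1 x2 x3] : [/\ x \in porbit ccw x, ccw x \in porbit ccw x,
    ccw2 x \in porbit ccw x & ccw3 x \in porbit ccw x].
  by rewrite Ux_E !inE !eqxx ?orbT.
have [y0 y1 y2 y3] : [/\ y \in porbit ccw y, ccw y \in porbit ccw y,
    ccw2 y \in porbit ccw y & ccw3 y \in porbit ccw y].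
  by rewrite Uy_E !inE !eqxx ?orbT.
set S := [set x; ccw x; y; ccw y] in f_keeps.
set U := porbit ccw x :|: porbit ccw y.
have s2 : ccw2 x \notin S by rewrite !inE n2 n4 !nxy.
have s3 : ccw3 x \notin S by rewrite !inE n3 n5 !nxy.
have r2 : ccw2 y \notin S by rewrite !inE m2 m4 !nyx.
have r3 : ccw3 y \notin S by rewrite !inE m3 m5 !nyx.
have [u2 u2E] := keeps_outside_pre f_keeps s2.
have [u3 u3E] := keeps_outside_pre f_keeps s3.
have [v2 v2E] := keeps_outside_pre f_keeps r2.
have [v3 v3E] := keeps_outside_pre f_keeps r3.
have cu2 : ccw u2 = v3 by apply: f_inj; rewrite f_ccw -u2E eqxx.
have cv3 : ccw v3 = u2 by apply: f_inj; rewrite f_ccw -v3E nyx ?eqxx.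
have cu3 : ccw u3 = v2 by apply: f_inj; rewrite f_ccw -u3E n6 nxy ?eqxx.
have cv2 : ccw v2 = u3.
  by apply: f_inj; rewrite f_ccw -v2E nyx // [_ == ccw3 y]eq_sym m6 nyx ?eqxx.
have bead2 (u v : dart D') : ccw u = v -> ccw v = u -> at_bead u.
  by move=> uv vu; rewrite /at_bead /ccw2 uv vu.
have fU u : f u \in U -> [\/ u = u2, u = u3, u = v2 | u = v3].
  have := keeps_outsideN f_keeps u.
  rewrite /U Ux_E Uy_E !inE -!orbA !negb_or => /and4P[/negbTE -> /negbTE ->].
  move=> /negbTE -> /negbTE -> /=.
  case/or4P=> /eqP E; [constructor 1|constructor 2|constructor 3|constructor 4];
    by apply: f_inj; rewrite E.
apply: (colorless_transfer (U := U) f_keeps).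
- move=> d; rewrite !in_setU -!(eq_porbit_mem _ d) -!(eq_porbit_mem _ (ccw d)).
  by rewrite porbit_step.
- move=> u uU; rewrite f_ccw; do 4?[case: eqP => [E|_] //];
    by case/negP: uU; rewrite E in_setU ?x2 ?x3 ?y2 ?y3 ?orbT.
- apply/subsetP=> d; rewrite in_setU !inE -!orbA.
  by case/or4P => /eqP ->; rewrite ?x0 ?x1 ?y0 ?y1 ?orbT.
- move=> M t tc; have [t_opp t_v] := tc.
  have tcy : t (ccw y) = t x by rewrite -oxE t_opp.
  have ty : t y = t (ccw x) by rewrite -ocxE t_opp.
  have [E1 E2] : t (ccw3 y) = t (ccw2 x) /\ t (ccw2 y) = t (ccw3 x).
    have [ox|ox] := boolP (over x).
      have oy : ~~ over y by rewrite -over_ccw // -oxy.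
      have [-> Ex] := coloring_over tc Xx ox.
      have [-> Ey] := coloring_under tc Xy oy.
      split=> //; apply: (@addrI _ (t (ccw x))).
      by rewrite Ex -ty Ey tcy.
    have oy : over y by rewrite -[over y]negbK -over_ccw // -oxy.
    have [-> Ex] := coloring_under tc Xx ox.
    have [-> Ey] := coloring_over tc Xy oy.
    split=> //; apply: (@addrI _ (t x)).
    by rewrite Ex -tcy Ey ty.
  split=> [u|u|a ta d].
  + by rewrite f_opp t_opp.
  + case/fU=> ->; rewrite /vertex_rule;
      [rewrite (bead_crossingF (bead2 _ _ cu2 cv3)) cu2
      |rewrite (bead_crossingF (bead2 _ _ cu3 cv2)) cu3
      |rewrite (bead_crossingF (bead2 _ _ cv2 cu3)) cv2
      |rewrite (bead_crossingF (bead2 _ _ cv3 cu2)) cv3];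
    by rewrite /= -?u2E -?u3E -?v2E -?v3E ?E1 ?E2; split.
  have t2 : t (ccw2 x) = a by rewrite u2E ta.
  have t3 : t (ccw3 x) = a by rewrite u3E ta.
  have [tx tcx] : t x = a /\ t (ccw x) = a.
    have [ox|ox] := boolP (over x).
      have [E3 E4] := coloring_over tc Xx ox; rewrite -E3 t2 t3 in E4 *.
      by split=> //; apply: addIr E4.
    have [E3 E4] := coloring_under tc Xx ox; rewrite -E3 t2 t3 in E4 *.
    by split=> //; apply: addIr E4.
  by rewrite !inE -!orbA; case/or4P => /eqP ->; rewrite ?tcy ?ty ?tcx.
move=> M t' [t'_opp t'_v].
(* The side [x, ccw y] of the bigon gets the color [A] and the side
   [ccw x, y] the color [B]: the upper strand keeps its color, and the crossings
   impose the color of the lower one. *)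
pose A := if over x then t' u2 else t' u3 + t' u3 - t' u2.
pose B := if over x then t' u2 + t' u2 - t' u3 else t' u3.
exists (fun d => if (d == x) || (d == ccw y) then A else B) => t tf th.
have tx : t x = A by rewrite th ?inE ?eqxx.
have tcx : t (ccw x) = B by rewrite th ?inE ?eqxx ?orbT // n1 nxy.
have ty : t y = B.
  by rewrite th ?inE ?eqxx ?orbT // nyx // [_ == ccw y]eq_sym m1.
have tcy : t (ccw y) = A by rewrite th ?inE ?eqxx ?orbT.
have t2 : t (ccw2 x) = t' u2 by rewrite u2E tf.
have t3 : t (ccw3 x) = t' u3 by rewrite u3E tf.
have ty3 : t (ccw3 y) = t' u2.
  by rewrite v3E tf -cu2; case: (t'_v u2) => + _; apply; apply: bead2 cu2 cv3.
have ty2 : t (ccw2 y) = t' u3.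
  by rewrite v2E tf -cu3; case: (t'_v u3) => + _; apply; apply: bead2 cu3 cv2.
split=> d.
  have [|dS] := boolP (d \in S).
    rewrite !inE -!orbA; case/or4P => /eqP ->.
    - by rewrite oxE tx.
    - by rewrite ocxE ty.
    - by rewrite -ocxE opp_inv ocxE ty.
    by rewrite -oxE opp_inv oxE tcy.
  have [w ->] := keeps_outside_pre f_keeps dS.
  by rewrite -f_opp !tf t'_opp.
rewrite in_setU => /orP[]; have [ox|ox] := boolP (over x).
- apply: vertex_rule_over => //; rewrite ?t2 ?t3 ?tcx ?tx /A /B ox //.
  by rewrite subrK.
- apply: vertex_rule_under => //; rewrite ?t2 ?t3 ?tcx ?tx /A /B (negbTE ox) //.
  by rewrite subrK.
- have oy : ~~ over y by rewrite -over_ccw // -oxy.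
  apply: vertex_rule_under => //; rewrite ?ty2 ?ty3 ?tcy ?ty /A /B ox //.
  by rewrite subrK.
have oy : over y by rewrite -[over y]negbK -over_ccw // -oxy.
apply: vertex_rule_over => //; rewrite ?ty2 ?ty3 ?tcy ?ty /A /B (negbTE ox) //.
by rewrite subrK.
Qed.

(** The symmetry [w |-> a - w] maps [u], [v] and the point [v + v - u] symmetric
to [u] with respect to [v] to three points in the same position. This
distributivity underlies the third Reidemeister move. *)
Lemma reflect_midpoint (M : zmodType) (a u v : M) :
  (a - u) + (a - (v + v - u)) = (a - v) + (a - v).
Proof. by rewrite opprB addrCA subrKA [RHS]addrACA opprD [LHS]addrA. Qed.

Section Triangle.
Variables (D : diagram) (x y z : dart D).
Hypotheses (Xx : at_crossing x) (Xy : at_crossing y) (Xz : at_crossing z).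
Hypotheses (nxy : y \notin porbit ccw x) (nxz : z \notin porbit ccw x).
Hypothesis nyz : z \notin porbit ccw y.

(** The twelve darts at the vertices of a triangle, numbered so that equality
of two of them is decided by comparing numbers. *)
Definition tri_darts : seq (dart D) :=
  [:: x; ccw x; ccw2 x; ccw3 x; y; ccw y; ccw2 y; ccw3 y;
      z; ccw z; ccw2 z; ccw3 z].

Let g i := nth x tri_darts i.

Lemma mem_tri_darts d : (d \in tri_darts) =
  [|| d \in porbit ccw x, d \in porbit ccw y | d \in porbit ccw z].
Proof. by rewrite !porbit_ccwE !inE -!orbA. Qed.

Lemma tri_darts_uniq : uniq tri_darts.
Proof.
have orb_uniq v : at_crossing v -> uniq [:: v; ccw v; ccw2 v; ccw3 v].
  move=> Xv; have [[c1 c2 c3] [c4 c5 c6]] := ccw_neqs Xv.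
  rewrite /= !inE ![v == _]eq_sym ![ccw v == ccw2 _]eq_sym.
  rewrite ![ccw2 v == ccw3 _]eq_sym.
  by rewrite c1 c2 c3 c4 c5 c6.
have orb_mem v d : (d \in [:: v; ccw v; ccw2 v; ccw3 v]) = (d \in porbit ccw v).
  by rewrite porbit_ccwE !inE -!orbA.
have orb_disj v w : w \notin porbit ccw v ->
    ~~ has (mem [:: v; ccw v; ccw2 v; ccw3 v]) [:: w; ccw w; ccw2 w; ccw3 w].
  apply: contra => /hasP[d]; rewrite /= !orb_mem => dw dv.
  by move: dw dv; rewrite -!eq_porbit_mem => /eqP -> /eqP ->.
rewrite -[tri_darts]/([:: x; ccw x; ccw2 x; ccw3 x]
  ++ [:: y; ccw y; ccw2 y; ccw3 y] ++ [:: z; ccw z; ccw2 z; ccw3 z]).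
rewrite !cat_uniq !orb_uniq // has_cat negb_or !orb_disj //.
Qed.

Lemma tri_tperm i j k : (i < 12)%N -> (j < 12)%N -> (k < 12)%N ->
  tperm (g i) (g j) (g k) = g (if k == i then j else if k == j then i else k).
Proof.
move=> i12 j12 k12; have U := tri_darts_uniq.
have eqg a b : (a < 12)%N -> (b < 12)%N -> (g a == g b) = (a == b).
  by move=> a12 b12; apply: nth_uniq.
case: tpermP => [/eqP|/eqP|/eqP + /eqP]; rewrite !eqg //.
- by move=> ->.
- by move=> /eqP ->; rewrite eqxx; case: eqP => [->|].
by move=> /negbTE -> /negbTE ->.
Qed.

Lemma tri_dartsP d : d \in tri_darts -> exists2 i, (i < 12)%N & d = g i.
Proof. by move/(nthP x) => [i i12 <-]; exists i. Qed.

(* The involution of the indices that [R3_swap] induces. *)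
Let r i := nth 0%N [:: 11; 6; 9; 4; 3; 10; 1; 8; 7; 2; 5; 0] i.

Lemma R3_swap_tri i : (i < 12)%N -> R3_swap x y z (g i) = g (r i).
Proof.
move=> i12.
have -> : R3_swap x y z = (tperm (g 0) (g 11) * tperm (g 2) (g 9)
  * tperm (g 4) (g 3) * tperm (g 6) (g 1) * tperm (g 8) (g 7)
  * tperm (g 10) (g 5))%g by [].
by move: i i12; do 12![case=> [_|]; first by rewrite !permM !tri_tperm].
Qed.

Lemma R3_swap_out d : d \notin tri_darts -> R3_swap x y z d = d.
Proof.
move=> dT; have nd i : (i < 12)%N -> g i != d.
  by move=> i12; apply: contraNneq dT => <-; apply: mem_nth.
have tD i j : (i < 12)%N -> (j < 12)%N -> tperm (g i) (g j) d = d.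
  by move=> i12 j12; rewrite tpermD ?nd.
have -> : R3_swap x y z = (tperm (g 0) (g 11) * tperm (g 2) (g 9)
  * tperm (g 4) (g 3) * tperm (g 6) (g 1) * tperm (g 8) (g 7)
  * tperm (g 10) (g 5))%g by [].
by rewrite !permM !tD.
Qed.

Lemma R3_swapK d : R3_swap x y z (R3_swap x y z d) = d.
Proof.
have [/tri_dartsP[i i12 ->]|dT] := boolP (d \in tri_darts); last first.
  by rewrite !R3_swap_out.
rewrite R3_swap_tri // R3_swap_tri.
  by move: i i12; do 12![case=> [_ //|]].
by move: i i12; do 12![case=> [_ //|]].
Qed.

(** The triangle obtained by the move has its corners opposite to those of the
original one; undoing the move exchanges the same darts. *)
Lemma R3_swap_opposite : R3_swap (ccw2 x) (ccw2 y) (ccw2 z) =1 R3_swap x y z.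
Proof.
have -> : R3_swap (ccw2 x) (ccw2 y) (ccw2 z) =
  (tperm (g 2) (g 9) * tperm (g 0) (g 11)
  * tperm (g 6) (g 1) * tperm (g 4) (g 3) * tperm (g 10) (g 5)
  * tperm (g 8) (g 7))%g.
  by rewrite /R3_swap /ccw3 /ccw2 !ccw_order.
move=> d; have [/tri_dartsP[i i12 ->]|dT] := boolP (d \in tri_darts).
  rewrite R3_swap_tri //.
  by move: i i12; do 12![case=> [_|]; first by rewrite !permM !tri_tperm].
have nd i : (i < 12)%N -> g i != d.
  by move=> i12; apply: contraNneq dT => <-; apply: mem_nth.
have tD i j : (i < 12)%N -> (j < 12)%N -> tperm (g i) (g j) d = d.
  by move=> i12 j12; rewrite tpermD ?nd.
by rewrite R3_swap_out // !permM !tD.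
Qed.

Hypotheses (oxy : opp (ccw x) = y) (oyz : opp (ccw y) = z).
Hypothesis ozx : opp (ccw z) = x.
Hypotheses (ox : over (ccw x)) (oy : over y).

(** Coloring after a third Reidemeister move: the three strands enter and leave
the triangle with the same colors, and the sides of the new triangle receive the
colors that the crossings impose. *)
Lemma R3_recolor (M : zmodType) (t : dart D -> M) : coloring t ->
  exists t' : dart D -> M,
    [/\ forall d, t' (R3_swap x y z (opp (R3_swap x y z d))) = t' d,
        forall d, vertex_rule t' d &
        forall a, (forall d, t' d = a) -> forall d, t d = a].
Proof.
move=> tc; have [t_opp t_v] := tc; pose a := t y.
have tcx : t (ccw x) = a by rewrite /a -oxy t_opp.
have tcy : t (ccw y) = t z by rewrite -oyz t_opp.
have tcz : t (ccw z) = t x by rewrite -ozx t_opp.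
have ux : ~~ over x by rewrite -over_ccw.
have [t3x Ex] := coloring_under tc Xx ux; rewrite tcx in t3x Ex.
have [t2y Ey] := coloring_over tc Xy oy; rewrite tcy -/a in t2y Ey.
have pE : t (ccw2 x) = a + a - t x by rewrite -Ex addrC addKr.
have sE : t (ccw3 y) = a + a - t z by rewrite -Ey [t z + _]addrC addrK.
(* The new colors, in the order of [tri_darts]. A side of the new triangle,
   where [R3_swap] brings an outer dart, keeps the color of that dart. *)
pose cols := [:: t (ccw3 z); a; a + a - t (ccw3 z); a;
  a; t (ccw2 z); a; a + a - t (ccw2 z);
  t (ccw3 y); t (ccw2 x); a + a - t (ccw2 z); a + a - t (ccw3 z)].
pose t' d := if d \in tri_darts then nth 0 cols (index d tri_darts) else t d.
have t'g i : (i < 12)%N -> t' (g i) = nth 0 cols i.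
  by move=> i12; rewrite /t' mem_nth // index_uniq // tri_darts_uniq.
have t'out d : d \notin tri_darts -> t' d = t d by rewrite /t' => /negbTE ->.
have rule d : d \notin tri_darts -> vertex_rule t' d.
  move=> dT; have out e : e \in porbit ccw d -> t' e = t e.
    rewrite -eq_porbit_mem => /eqP E; apply: t'out; move: dT.
    by rewrite !mem_tri_darts -!(eq_porbit_mem _ d) -!(eq_porbit_mem _ e) E.
  have [P Q] := t_v d.
  by rewrite /vertex_rule !out // porbit_ccwE !inE eqxx ?orbT.
(* The sides of the triangle: their six darts are exchanged by [opp]. *)
pose sides := [:: 0; 1; 4; 5; 8; 9]%N.
pose oppi i := nth 0%N [:: 9; 4; 0; 0; 1; 8; 0; 0; 5; 0]%N i.
have opp_side i : i \in sides -> opp (g i) = g (oppi i) /\ oppi i \in sides.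
  rewrite !inE; do ![case/predU1P=> [->|]]; last move/eqP=> ->; split=> //;
  rewrite /g /=; apply/eqP; rewrite opp_eq eq_sym; exact/eqP.
have side12 i : i \in sides -> (i < 12)%N by do ![case/predU1P=> [->|]].
pose is_side d := d \in [seq g i | i <- sides].
have opp_is_side d : is_side (opp d) -> is_side d.
  case/mapP=> i /opp_side[E iS] dE; apply/mapP; exists (oppi i) => //.
  by rewrite -E -dE opp_inv.
have t'R d : ~~ is_side d -> t' (R3_swap x y z d) = t d.
  move=> dS.
  have [/tri_dartsP[i i12 dE]|dT] := boolP (d \in tri_darts); last first.
    by rewrite R3_swap_out ?t'out.
  have : i \notin sides by apply: contra dS => iS; rewrite dE; apply: map_f.
  rewrite dE R3_swap_tri // => {dE dS}.
  by move: i i12; do 12![case=> [_|]; first by rewrite ?t'g].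
exists t'; split.
- move=> d; set o := R3_swap x y z d.
  have dE : d = R3_swap x y z o by rewrite R3_swapK.
  have [/mapP[i iS oE]|oS] := boolP (is_side o).
    have [E jS] := opp_side i iS.
    rewrite dE oE E !R3_swap_tri ?side12 //.
    move: iS; rewrite !inE; do ![case/predU1P=> [->|]]; last move/eqP=> ->;
      by rewrite !t'g.
  rewrite t'R; last by apply: contra oS => /opp_is_side.
  by rewrite t_opp dE t'R.
- move=> d; have [|/rule//] := boolP (d \in tri_darts); rewrite mem_tri_darts.
  case/or3P; last first.
  + have [oz|uz] := boolP (over z).
      have [t2z E] := coloring_over tc Xz oz; rewrite tcz in E.
      apply: vertex_rule_over => //.
        by rewrite (t'g 10) // (t'g 8) //= sE t2z.
      rewrite (t'g 9) // (t'g 11) // (t'g 8) //= pE sE.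
      by rewrite -(reflect_midpoint _ (t x)) -E [t x + _]addrC addrK.
    have [t3z E] := coloring_under tc Xz uz; rewrite tcz in t3z E.
    apply: vertex_rule_under => //.
      by rewrite (t'g 11) // (t'g 9) //= pE t3z.
    rewrite (t'g 8) // (t'g 10) // (t'g 9) //= pE sE.
    by rewrite -(reflect_midpoint _ (t z)) -E [t z + _]addrC addrK.
  + apply: vertex_rule_over => //; first by rewrite (t'g 6) // (t'g 4).
    by rewrite (t'g 5) // (t'g 7) // (t'g 4) //= addrC subrK.
  apply: vertex_rule_under => //; first by rewrite (t'g 3) // (t'g 1).
  by rewrite (t'g 0) // (t'g 2) // (t'g 1) //= addrC subrK.
move=> k t'k.
have out_k d : ~~ is_side d -> t d = k by move=> dS; rewrite -t'R.
have ak : a = k by rewrite -(t'k (g 1)) t'g.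
have xk : t (ccw2 x) = k by rewrite -(t'k (g 9)) t'g.
have yk : t (ccw3 y) = k by rewrite -(t'k (g 8)) t'g.
have txk : t x = k.
  by apply: (@addIr _ k); rewrite -{1}xk Ex ak.
have tzk : t z = k.
  by apply: (@addIr _ k); rewrite -{1}yk Ey ak.
move=> d; have [/mapP[i iS ->]|/out_k //] := boolP (is_side d).
move: iS; rewrite !inE; do ![case/predU1P=> [->|]]; last move/eqP=> ->;
  by rewrite /g /= ?tcx ?tcy ?tcz.
Qed.
End Triangle.

(** The converse follows from the symmetry of the move. *)
Lemma colorless_R3_half (D D' : diagram) :
  R3_move D D' -> colorless D' -> colorless D.
Proof.
move=> [x [y [z [f [[Xx Xy Xz] [nxy nxz nyz] [oxy oyz ozx] /andP[ox oy]
  [[h fK hK] f_ccw f_over f_opp]]]]]] triv M t tc.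
have [t' [t'_opp t'_v t'_const]] :=
  R3_recolor Xx Xy Xz nxy nxz nyz oxy oyz ozx ox oy tc.
have f_keeps : keeps_outside set0 f.
  split; [exact: can_inj fK | | exact: f_over] => d.
  by rewrite inE; apply/codomP; exists (h d); rewrite hK.
have t'fc : coloring (t' \o f).
  split=> u; first by rewrite /= f_opp t'_opp.
  apply/(unchanged_vertex_rule (U := set0) f_keeps) => //.
  - by move=> d; rewrite inE.
  - by rewrite inE.
move=> d e; have t'k d' : t' d' = t' d.
  by rewrite -[d']hK -[d]hK; apply: (triv M _ t'fc).
by rewrite !(t'_const _ t'k).
Qed.

Lemma R3_move_sym (D D' : diagram) : R3_move D D' -> R3_move D' D.
Proof.
move=> [x [y [z [f [[Xx Xy Xz] [nxy nxz nyz] [oxy oyz ozx] /andP[ox oy]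
  [[h fK hK] f_ccw f_over f_opp]]]]]].
have f_inj := can_inj fK.
have h_ccw d : h (ccw d) = ccw (h d) by apply: f_inj; rewrite f_ccw !hK.
have f_ccw2 u : f (ccw2 u) = ccw2 (f u) by rewrite /ccw2 !f_ccw.
have f_ccw3 u : f (ccw3 u) = ccw3 (f u) by rewrite /ccw3 !f_ccw.
have fX u : at_crossing (f u) = at_crossing u.
  by rewrite /at_crossing -f_ccw2 (inj_eq f_inj).
have f_R u : f (R3_swap (h (ccw2 x)) (h (ccw2 y)) (h (ccw2 z)) u) =
    R3_swap x y z (f u).
  rewrite -(R3_swap_opposite Xx Xy Xz nxy nxz nyz) /R3_swap !permM.
  by rewrite !(inj_tperm _ _ _ f_inj) !f_ccw3 !f_ccw2 !f_ccw !hK.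
have f_porbit u v : v \in porbit ccw u -> f v \in porbit ccw (f u).
  move=> /porbitP[i ->]; elim: i => [|i IHi]; first by rewrite perm1 porbit_id.
  rewrite expgSr permM f_ccw.
  by rewrite -eq_porbit_mem porbit_step eq_porbit_mem.
have orb2 (u v : dart D) :
    (ccw2 v \in porbit ccw (ccw2 u)) = (v \in porbit ccw u).
  by rewrite -!eq_porbit_mem /ccw2 !porbit_step.
have [Rcx Rcy Rcz] : [/\ R3_swap x y z (ccw x) = ccw2 y,
    R3_swap x y z (ccw y) = ccw2 z & R3_swap x y z (ccw z) = ccw2 x].
  have Rg := R3_swap_tri Xx Xy Xz nxy nxz nyz.
  by split; [apply: (Rg 1%N) | apply: (Rg 5%N) | apply: (Rg 9%N)].
have [Rx Ry Rz] : [/\ R3_swap x y z (ccw3 x) = y,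
    R3_swap x y z (ccw3 y) = z & R3_swap x y z (ccw3 z) = x].
  have Rg := R3_swap_tri Xx Xy Xz nxy nxz nyz.
  by split; [apply: (Rg 3%N) | apply: (Rg 7%N) | apply: (Rg 11%N)].
have RK := R3_swapK Xx Xy Xz nxy nxz nyz.
have opp_h u v : R3_swap x y z (opp (R3_swap x y z (ccw3 u))) = ccw2 v ->
    opp (ccw (h (ccw2 u))) = h (ccw2 v).
  by move=> E; apply: f_inj; rewrite f_opp f_ccw !hK.
have oppV (d e : dart D) : opp d = e -> opp e = d by move=> <-; rewrite opp_inv.
exists (h (ccw2 x)), (h (ccw2 y)), (h (ccw2 z)), h; split.
- by rewrite -!fX !hK /ccw2 !at_crossing_ccw.
- by split; apply/negP => /f_porbit; rewrite !hK orb2; apply/negP.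
- split; apply: opp_h; rewrite ?Rx ?Ry ?Rz.
  + by rewrite (oppV _ _ oxy) Rcx.
  + by rewrite (oppV _ _ oyz) Rcy.
  by rewrite (oppV _ _ ozx) Rcz.
- rewrite -!f_over ?at_crossing_ccw -?fX ?f_ccw ?hK ?at_crossing_ccw //.
  by rewrite over_ccw2 // oy -/(ccw3 x) over_ccw3 // -over_ccw // ox.
split=> [||d Xd|d].
- by exists f.
- by move=> d; rewrite h_ccw.
- by rewrite -f_over ?hK // -fX hK.
by apply: f_inj; rewrite f_R f_opp f_R !hK !RK.
Qed.

Lemma colorless_reidemeister (D D' : diagram) :
  reidemeister D D' -> (colorless D <-> colorless D').
Proof.
case=> [|||[|mv]].
- exact: colorless_isomorphic.
- exact: colorless_bead_move.
- exact: colorless_R1_move.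
- exact: colorless_R2_move.
by split; apply: colorless_R3_half => //; apply: R3_move_sym.
Qed.

Lemma colorless_same_link (D D' : diagram) :
  same_link D D' -> (colorless D <-> colorless D').
Proof.
elim=> {D D'} [D D' /colorless_reidemeister //| //|D D' _ [p q] //|].
by move=> D1 D2 D3 _ [p q] _ [p' q']; split; auto.
Qed.

Lemma mem_crossings (D : diagram) (d : dart D) :
  at_crossing d -> porbit ccw d \in crossings D.
Proof.
move=> Xd; rewrite inE imset_f //=.
have [[c1 c2 c3] [c4 c5 c6]] := ccw_neqs Xd.
rewrite porbit_ccwE -!setUA !cardsU1 cards1 !inE.
by rewrite ![d == _]eq_sym ![ccw d == ccw2 _]eq_sym ![ccw2 d == ccw3 _]eq_sym
  c1 c2 c3 c4 c5 c6.
Qed.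

Lemma trivial_knot_colorless (D : diagram) : trivial_knot D -> colorless D.
Proof.
case=> D' link [noX one].
apply/(colorless_same_link link) => M t [t_opp t_v] d e.
have conn := (@n_comp1P _ (@ccw D') opp d).
have {}conn : forall x y, connect (linked (@ccw D') opp) x y.
  by apply/conn; rewrite -/(components D') one.
have t_ccw x : t (ccw x) = t x.
  have [+ _] := t_v x; apply; rewrite at_beadN; apply/negP => /mem_crossings.
  by rewrite noX inE.
symmetry; apply/eqP.
apply: (@linked_closed _ ccw opp [pred x | t x == t d] _ _ _ _ (conn d e)).
- by move=> x; rewrite !inE t_ccw.
- by move=> x; rewrite !inE t_opp.
by rewrite inE.
Qed.

(** * Finitely presented abelian groups *)

Section Presentation.
Variables (V : zmodType) (I : eqType) (F : I -> V) (r : seq I).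

(** The class in the presented group of an element of the group [V] of which it
is a quotient. *)
Definition pres_class (s : seq V) (v : V) : presented_group s :=
  \pi_(presented_group s)%qT v.

Lemma pres_classMn s n : {morph @pres_class s : u / u *+ n}.
Proof. exact: raddfMn. Qed.

Lemma pres_class_eq s u v :
  pres_class s u = pres_class s v <-> inIntSpan (in_tuple s) (u - v).
Proof.
split=> [/eqP|uv].
  by rewrite /pres_class -Quotient.idealrBE => /asboolP.
by apply/eqP; rewrite /pres_class -Quotient.idealrBE; apply/asboolP.
Qed.

(** Two elements with the same class differ by an integral combination of the
relators, here indexed by a duplicate-free sequence. *)
Lemma pres_class_span s u v :
    uniq r -> s = [seq F i | i <- r] -> pres_class s u = pres_class s v ->
  exists a : I -> int, u - v = \sum_(i <- r) F i *~ a i.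
Proof.
move=> Ur sE /pres_class_eq[b ->]; rewrite {}sE in b *.
set s0 := [seq F i | i <- r] in b *.
pose a i := if insub (index i r) is Some k then b k else 0.
exists a; have [r0|r_gt0] := posnP (size r).
  rewrite (size0nil r0) big_nil big1 // => k _.
  by have : (k < size r)%N; [rewrite -(size_map F r) | rewrite r0].
have [x0 _] : exists x0, x0 \in r.
  by case: (r) r_gt0 => // x0 r' _; exists x0; rewrite mem_head.
rewrite (big_nth x0) -(size_map F r) big_mkord; apply: eq_bigr => k _.
have k_r : (k < size r)%N by rewrite -(size_map F r).
rewrite (nth_map x0) //; congr (_ *~ _).
by rewrite /a index_uniq // -/s0 valK.
Qed.

Lemma pres_class_relator s v : v \in s -> pres_class s v = 0.
Proof.
move=> vs; rewrite -(raddf0 (pres_class s)); apply/pres_class_eq; rewrite subr0.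
have v_s : (index v s < size s)%N by rewrite index_mem.
exists [ffun k : 'I_(size s) => (k == Ordinal v_s)%:R].
rewrite (bigD1 (Ordinal v_s)) //= big1 ?addr0 => [|k /negbTE kN].
  by rewrite ffunE eqxx mulr1z nth_index.
by rewrite ffunE kN mulr0z.
Qed.

End Presentation.

Lemma Zp_mulrn_dvd p n (z : 'Z_p) : (1 < p)%N -> (p %| n)%N -> z *+ n = 0.
Proof.
move=> p_gt1 /dvdnP[q ->]; rewrite mulnC mulrnA -[z *+ p]mulr_natr.
by rewrite pchar_Zp // mulr0 mul0rn.
Qed.

Lemma largest_invariant_factor_annihilates (G : zmodType) n (x : G) :
  largest_invariant_factor G n -> (1 < n)%N /\ x *+ n = 0.
Proof.
move=> [ns [/= /andP[n_gt1 ns_gt1] ns_dvd [f [fD f_inj _]]]]; split=> //.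
have dvd_trans : transitive (fun a b : nat => b %| a)%N.
  by move=> b a d ab bd; apply: dvdn_trans bd ab.
have ns_n : all (fun b => b %| n)%N (n :: ns).
  by rewrite /= dvdnn; apply: order_path_min ns_dvd.
apply: f_inj => i; have f0 : f i 0 = 0.
  by apply: (@addrI _ (f i 0)); rewrite -fD !addr0.
have fMn k : f i (x *+ k) = f i x *+ k.
  by elim: k => [|k IHk]; rewrite ?mulr0n // !mulrSr fD IHk.
have n_i : nth 0%N (n :: ns) i \in n :: ns by rewrite mem_nth.
have p_gt1 : (1 < nth 0%N (n :: ns) i)%N.
  by move: n_i; rewrite inE => /orP[/eqP -> //|]; move/(allP ns_gt1).
by rewrite fMn; apply: Zp_mulrn_dvd p_gt1 (allP ns_n _ n_i).
Qed.

Lemma ffun_intmul (T : finType) (u : {ffun T -> int}) (n : int) x :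
  (u *~ n) x = u x * n.
Proof.
case: n => n;
  rewrite ?NegzE ?mulrNz -?pmulrn ?ffunE ?ffunMnE -mulr_natr ?natz //.
by rewrite mulrN.
Qed.

(** * Cuts of an alternating diagram *)

Section Cuts.
Variable D : diagram.
Hypotheses (Xall : crossings_only D) (alt : alternating D).
Implicit Types (d e p x y : dart D) (A B : {set dart D}).

Lemma over_opp d : over (opp d) = ~~ over d. Proof. exact: alt. Qed.

Lemma ccw_cases d e : e \in porbit ccw d -> over e = over d ->
  e = d \/ e = ccw2 d.
Proof.
rewrite porbit_ccwE !inE -!orbA; case/or4P => /eqP ->; auto.
  by rewrite over_ccw //; case: (over d).
by rewrite over_ccw3 //; case: (over d).
Qed.

Lemma ccw_cases_neq d e : e \in porbit ccw d -> over e != over d ->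
  e = ccw d \/ e = ccw3 d.
Proof.
rewrite porbit_ccwE !inE -!orbA; case/or4P => /eqP ->; auto.
  by rewrite eqxx.
by rewrite over_ccw2 // eqxx.
Qed.

Lemma sum_vertex_over (R : nmodType) (F : dart D -> R) d : over d ->
  \sum_(e | over e && (e \in porbit ccw d)) F e = F d + F (ccw2 d).
Proof.
move=> od; have [[_ n2 _] _] := ccw_neqs (Xall d).
rewrite (bigD1 d) ?od ?porbit_id //=; congr (_ + _).
rewrite (big_pred1 (ccw2 d)) // => e /=.
apply/andP/eqP => [[/andP[oe ed]] ned|->].
  by have [E|//] := ccw_cases ed (etrans oe (esym od)); rewrite E eqxx in ned.
by rewrite over_ccw2 // od n2 porbit_ccwE !inE eqxx ?orbT.
Qed.

(** A set of vertices is represented by the set of their darts. Likewise,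
functions on vertices are functions on darts that are invariant under [ccw]. *)
Definition vertex_set A := forall d, d \in A -> ccw d \in A.

Lemma vertex_setE A d e :
  vertex_set A -> e \in porbit ccw d -> (e \in A) = (d \in A).
Proof.
move=> vA ed; apply/idP/idP => [eA|dA]; last first.
  exact: (@porbit_closed _ ccw A d e vA dA ed).
by apply: (@porbit_closed _ ccw A e d vA eA); rewrite porbit_sym.
Qed.

Lemma vertex_setC A : vertex_set A -> vertex_set (~: A).
Proof. by move=> vA d; rewrite !inE (vertex_setE vA (mem_porbit1 _ _)). Qed.

Lemma vertex_setI A B : vertex_set A -> vertex_set B -> vertex_set (A :&: B).
Proof. by move=> vA vB d; rewrite !inE => /andP[/vA -> /vB ->]. Qed.

Lemma vertex_setU A B : vertex_set A -> vertex_set B -> vertex_set (A :|: B).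
Proof. by move=> vA vB d; rewrite !inE => /orP[/vA|/vB] ->; rewrite ?orbT. Qed.

(** Edges are oriented from their over-end to their under-end; those that leave
or enter a set of vertices are represented by their dart in this set. *)
Definition out_edges A := [set d in A | over d && (opp d \notin A)].
Definition in_edges A := [set d in A | ~~ over d && (opp d \notin A)].

(** Each vertex has two outgoing and two incoming edges, so that as many edges
leave a set of vertices as enter it. *)
Lemma card_in_edges A : vertex_set A -> #|in_edges A| = #|out_edges A|.
Proof.
move=> vA.
pose ov := [set d in A | over d]; pose un := [set d in A | ~~ over d].
have E1 : #|ov| = #|un|.
  rewrite -(card_imset _ (@perm_inj _ ccw)); congr #|pred_of_set _|.
  apply/setP=> d; apply/imsetP/idP => [[e + ->]|].
    by rewrite !inE over_ccw // => /andP[/vA -> ->].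
  rewrite inE => /andP[dA ud]; exists (ccw3 d); last by rewrite ccw4.
  by rewrite !inE over_ccw3 // ud !vA.
pose ov_in := [set d in ov | opp d \in A].
pose un_in := [set d in un | opp d \in A].
have E2 : #|ov_in| = #|un_in|.
  rewrite -(card_imset _ (@perm_inj _ opp)); congr #|pred_of_set _|.
  apply/setP=> d; apply/imsetP/idP => [[e + ->]|].
    by rewrite !inE opp_inv over_opp negbK => /andP[/andP[-> ->] ->].
  rewrite !inE => /andP[/andP[dA ud] odA].
  exists (opp d); last by rewrite opp_inv.
  by rewrite !inE opp_inv over_opp odA dA ud.
have ov_split : #|ov| = (#|ov_in| + #|out_edges A|)%N.
  rewrite -(cardsID [set d | opp d \in A] ov); congr (_ + _)%N;
    by apply: eq_card => d; rewrite !inE -?andbA // andbC -andbA.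
have un_split : #|un| = (#|un_in| + #|in_edges A|)%N.
  rewrite -(cardsID [set d | opp d \in A] un); congr (_ + _)%N;
    by apply: eq_card => d; rewrite !inE -?andbA // andbC -andbA.
by apply: (@addnI #|un_in|); rewrite -un_split -E1 ov_split E2.
Qed.

Lemma card_out_edgesC A : vertex_set A -> #|out_edges (~: A)| = #|out_edges A|.
Proof.
move=> vA; rewrite -(card_in_edges vA) -(card_imset _ (@perm_inj _ opp)).
congr #|pred_of_set _|; apply/setP=> d; apply/imsetP/idP => [[e + ->]|].
  by rewrite !inE opp_inv over_opp !negbK => /and3P[-> -> ->].
rewrite !inE => /and3P[dA ud odA]; exists (opp d); last by rewrite opp_inv.
by rewrite !inE opp_inv over_opp dA ud odA.
Qed.

(** Submodularity of the number of outgoing edges. *)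
Lemma out_edges_submodular A B :
  (#|out_edges (A :&: B)| + #|out_edges (A :|: B)| <=
   #|out_edges A| + #|out_edges B|)%N.
Proof.
have cE X : #|out_edges X| =
    (\sum_d (d \in X) && (over d && (opp d \notin X)))%N.
  rewrite -sum1_card big_mkcond /=.
  by apply: eq_bigr => d _; rewrite !inE; case: ifP.
rewrite !cE -!big_split; apply: leq_sum => d _; rewrite !inE.
by case: (d \in A); case: (d \in B); case: (over d); case: (opp d \in A);
  case: (opp d \in B).
Qed.

Hypothesis conn : forall d e, connect (linked (@ccw D) opp) d e.

(** A balanced connected graph is strongly connected. *)
Lemma out_edges0 A d : vertex_set A -> #|out_edges A| = 0%N -> d \in A ->
  A = [set: dart D].
Proof.
move=> vA out0 dA; have in0 := card_in_edges vA; rewrite out0 in in0.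
apply/setP=> e; rewrite inE.
have oA z : z \in A -> opp z \in A.
  move=> zA; apply: contraTT isT => ozA; have [oz|uz] := boolP (over z).
    by have := cards0_eq out0 => /setP/(_ z); rewrite !inE zA oz ozA.
  by have := cards0_eq in0 => /setP/(_ z); rewrite !inE zA uz ozA.
exact: (@linked_closed _ ccw opp A d e vA oA (conn d e) dA).
Qed.

(** The Laplacian, at the vertex of an over-dart [d], of a function on vertices;
the two edges that leave this vertex start at [d] and [ccw2 d]. *)
Definition lap (R : zmodType) (f : dart D -> R) d : R :=
  f d + f d - f (opp d) - f (opp (ccw2 d)).

Lemma lapE (R : zmodType) (f : dart D -> R) d :
  (forall d, f (ccw d) = f d) ->
  lap f d = (f d - f (opp d)) + (f (ccw2 d) - f (opp (ccw2 d))).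
Proof. by move=> f_ccw; rewrite /lap /ccw2 !f_ccw addrACA addrA. Qed.

Lemma vertex_set_level (R : eqType) (f : dart D -> R) a :
  (forall d, f (ccw d) = f d) -> vertex_set [set d | f d == a].
Proof. by move=> f_ccw d; rewrite !inE f_ccw. Qed.

Lemma exists_max (R : realDomainType) (f : dart D -> R) x :
  exists d, forall e, f e <= f d.
Proof.
case: (@Order.TotalTheory.arg_maxP _ _ _ x predT f isT) => d _ dM.
by exists d => e; apply: dM.
Qed.

(** The maximum principle: a vertex where the maximum is reached and which is
harmonic has its two successors in the level set of the maximum. *)
Lemma harmonic_constant (R : realDomainType) (f : dart D -> R) :
    (forall d, f (ccw d) = f d) -> (forall d, over d -> lap f d = 0) ->
  forall d e, f d = f e.
Proof.
move=> f_ccw f0 d e; have [x xM] := exists_max f d.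
have vA := vertex_set_level (a := f x) f_ccw; set A := [set z | _] in vA.
have xA : x \in A by rewrite inE.
suff /out_edges0-/(_ _ vA xA) AT : #|out_edges A| = 0%N.
  have fx z : f z = f x.
    by have : z \in A; [rewrite AT inE | rewrite inE => /eqP].
  by rewrite !fx.
apply/eqP; rewrite cards_eq0; apply/set0Pn => -[z].
rewrite !inE => /and3P[/eqP zx oz]; have := f0 z oz; rewrite lapE //.
have := xM (opp z); have := xM (opp (ccw2 z)).
rewrite /ccw2 !f_ccw -/(ccw2 z) zx => l1 l2 E /negP; apply; lra.
Qed.

(** A potential with a unit source at [x] and a unit sink at [y]: as it is
integral, at most one edge leaves the level set of its maximum. *)
Lemma cut_of_potential (f : dart D -> int) x y :
    (forall d, f (ccw d) = f d) -> y \notin porbit ccw x ->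
    (forall d, over d ->
      lap f d = (d \in porbit ccw x)%:R - (d \in porbit ccw y)%:R) ->
  exists A, [/\ vertex_set A, x \in A, y \notin A & (#|out_edges A| <= 1)%N].
Proof.
move=> f_ccw xy f_lap; have [w wM] := exists_max f x.
have vA := vertex_set_level (a := f w) f_ccw; set A := [set z | _] in vA.
have wA : w \in A by rewrite inE.
have disj z : z \in porbit ccw x -> z \in porbit ccw y -> false.
  rewrite -!eq_porbit_mem => /eqP zx /eqP zy; case/negP: xy.
  by rewrite -eq_porbit_mem -zx zy.
(* The value drops along the two edges that leave a vertex of [A], by a total of
   1 at [x], of -1 at [y] and of 0 elsewhere; as no drop is negative, [y] is not
   in [A]. *)
have drop z : z \in A -> over z ->
    (z \in porbit ccw x)%:R - (z \in porbit ccw y)%:R =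
    (f w - f (opp z)) + (f w - f (opp (ccw2 z))).
  move=> /[!inE] /eqP zw oz; rewrite -f_lap // lapE //.
  by rewrite /ccw2 !f_ccw zw.
have out_x z : z \in out_edges A -> z \in porbit ccw x.
  rewrite !inE => /and3P[zw oz oz_w].
  have := drop z _ oz; rewrite inE => /(_ zw).
  have := wM (opp z); have := wM (opp (ccw2 z)).
  case: (z \in porbit ccw x) => //; case: (_ \in _) => /=; lia.
exists A; split=> //.
- apply: contraT => xA; have A0 : #|out_edges A| = 0%N.
    apply/eqP; rewrite cards_eq0; apply/set0Pn => -[z zo].
    have zx := out_x z zo; move: zo; rewrite inE => /andP[zA _].
    by rewrite -(vertex_setE vA zx) zA in xA.
  by rewrite (out_edges0 vA A0 wA) inE in xA.
- apply/negP => yA; have [y' y'y oy'] : exists2 z, z \in porbit ccw y & over z.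
    have [oy|uy] := boolP (over y); first by exists y; rewrite ?porbit_id.
    by exists (ccw y); rewrite ?mem_porbit1 ?over_ccw.
  have y'A : y' \in A by rewrite (vertex_setE vA y'y).
  have := drop y' y'A oy'; rewrite y'y.
  have := wM (opp y'); have := wM (opp (ccw2 y')).
  have : y' \notin porbit ccw x by apply/negP => /disj/(_ y'y).
  move=> /negbTE -> /=; lia.
apply/card_le1_eqP => z z' zo z'o.
have zx := out_x z zo; have z'x := out_x z' z'o.
have oz : over z by move: zo; rewrite inE => /and3P[].
have oz' : over z' by move: z'o; rewrite inE => /and3P[].
have z'z : z' \in porbit ccw z.
  by move: zx z'x; rewrite -!eq_porbit_mem => /eqP -> /eqP ->.
have [//|z'E] := ccw_cases z'z (etrans oz' (esym oz)).
move: zo z'o; rewrite !inE z'E => /and3P[zw _ n1] /and3P[_ _ n2].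
have := drop z _ oz; rewrite inE zw zx => /(_ isT).
have := wM (opp z); have := wM (opp (ccw2 z)).
have -> : (z \in porbit ccw y) = false by apply/negP => /(disj _ zx).
move=> /=; lia.
Qed.

End Cuts.

(** * Diagrams with only trivial colorings *)

Section Colorless.
Variable D : diagram.
Hypotheses (Xall : crossings_only D) (alt : alternating D).
Hypothesis D_colorless : colorless D.
Implicit Types (d e p x y : dart D) (A B : {set dart D}).

(** The generator of the over-arc at the vertex of [d], as the indicator
function of this vertex. *)
Definition vertex_generator d : {ffun dart D -> int} :=
  [ffun e => (e \in porbit ccw d)%:R].

(** The relator of the crossing of an under-dart [d]: the under-arcs are the
over-arcs at the other ends of [d] and [ccw2 d]. *)
Definition under_relator d : {ffun dart D -> int} :=
  vertex_generator d + vertex_generator d - vertex_generator (opp d)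
    - vertex_generator (opp (ccw2 d)).

Lemma vertex_generator_porbit d e :
  e \in porbit ccw d -> vertex_generator e = vertex_generator d.
Proof.
by rewrite -eq_porbit_mem => /eqP E; apply/ffunP=> z; rewrite !ffunE E.
Qed.

(** If all colorings are constant, then the universal one identifies all arcs:
the difference of two generators is an integral combination of relators, whose
coefficients are the sought potential. *)
Lemma colorless_potential x y : exists f : dart D -> int,
  (forall d, f (ccw d) = f d) /\
  (forall d, over d ->
     lap f d = (d \in porbit ccw x)%:R - (d \in porbit ccw y)%:R).
Proof.
pose r := enum [pred d : dart D | ~~ over d].
pose s := [seq under_relator d | d <- r].
pose g d := pres_class s (vertex_generator d).
(* The universal coloring: an under-dart has the color of the over-dart at the
   other end of its edge. *)
pose w d := g (if over d then d else opp d).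
have g_orb d e : e \in porbit ccw d -> g e = g d.
  by move=> ed; rewrite /g (vertex_generator_porbit ed).
have rel d : ~~ over d -> g (opp d) + g (opp (ccw2 d)) = g d + g d.
  move=> ud; apply/eqP; rewrite eq_sym -subr_eq0 opprD addrA -!raddfD -!raddfB.
  apply/eqP/pres_class_relator/mapP; exists d; last by [].
  by rewrite mem_enum.
have w_col : coloring w.
  split=> [d|d]; first by rewrite /w over_opp // opp_inv; case: (over d).
  split=> [|Xd od]; first by rewrite at_beadN Xall.
  rewrite /w over_ccw2 // over_ccw // over_ccw3 // od /=; split.
    by apply: g_orb; rewrite porbit_ccwE !inE eqxx ?orbT.
  have -> : ccw3 d = ccw2 (ccw d) by [].
  by rewrite rel ?over_ccw ?od // (g_orb d) // mem_porbit1.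
have [x' x'x ox'] : exists2 z, z \in porbit ccw x & over z.
  have [ox|ux] := boolP (over x); first by exists x; rewrite ?porbit_id.
  by exists (ccw x); rewrite ?mem_porbit1 ?over_ccw.
have [y' y'y oy'] : exists2 z, z \in porbit ccw y & over z.
  have [oy|uy] := boolP (over y); first by exists y; rewrite ?porbit_id.
  by exists (ccw y); rewrite ?mem_porbit1 ?over_ccw.
have /(pres_class_span (enum_uniq _) (erefl s))[a aE] : g x = g y.
  rewrite -(g_orb _ _ x'x) -(g_orb _ _ y'y).
  by have := D_colorless w_col x' y'; rewrite /w ox' oy'.
(* Each crossing has two under-darts, hence two copies of its relator, whose
   coefficients add up. *)
pose f d := if over d then a (ccw d) + a (ccw3 d) else a d + a (ccw2 d).
have f_ccw d : f (ccw d) = f d.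
  rewrite /f over_ccw //; case: (over d) => //=.
  by rewrite addrC; congr (a _ + a _); apply: ccw_order.
exists f; split=> // d od.
have := congr1 (fun u : {ffun dart D -> int} => u d) aE.
have big_r (G : dart D -> int) : \sum_(e <- r) G e = \sum_(e | ~~ over e) G e.
  by rewrite big_enum_cond; apply: eq_bigl => e; rewrite andbT.
rewrite !ffunE => ->; rewrite sum_ffunE big_r.
have sumE (h k : dart D -> dart D) : cancel k h -> cancel h k ->
    (forall e, over (k e) = ~~ over e) ->
    \sum_(e | ~~ over e) (d \in porbit ccw (h e))%:R * a e
    = a (k d) + a (k (ccw2 d)) :> int.
  move=> kK hK ok; rewrite (reindex k); last by exists h => e _.
  rewrite -(sum_vertex_over Xall (a \o k) od) [RHS]big_mkcondr.
  apply: eq_big => [e|e _]; first by rewrite ok negbK.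
  by rewrite kK porbit_sym /=; case: (_ \in _); rewrite ?mul1r ?mul0r.
have oppK := @opp_inv D.
have sum1 : \sum_(e | ~~ over e) (d \in porbit ccw e)%:R * a e = f d :> int.
  under eq_bigr => e _ do rewrite -porbit_step.
  rewrite (sumE _ (@ccw3 D)).
  - by rewrite /f od addrC /ccw3 /ccw2 ccw_order.
  - by move=> e; apply: ccw_order.
  - by move=> e; apply: ccw_order.
  by move=> e; rewrite over_ccw3.
have sum2 : \sum_(e | ~~ over e) (d \in porbit ccw (opp e))%:R * a e
    = a (opp d) + a (opp (ccw2 d)) :> int.
  by apply: sumE => // e; apply: over_opp.
have sum3 : \sum_(e | ~~ over e) (d \in porbit ccw (opp (ccw2 e)))%:R * a e
    = a (ccw2 (opp d)) + a (ccw2 (opp (ccw2 d))) :> int.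
  apply: (sumE (opp \o @ccw2 D) (@ccw2 D \o opp)) => e /=.
  - by rewrite ccw2K oppK.
  - by rewrite oppK ccw2K.
  by rewrite over_ccw2 // over_opp.
under eq_bigr => e _ do
  rewrite ffun_intmul /under_relator !ffunE !mulrBl mulrDl.
rewrite !sumrB big_split /= sum1 sum2 sum3 /lap.
rewrite {3 4}/f !over_opp // over_ccw2 // od /= -!addrA; congr (_ + (_ + _)).
by rewrite !opprD -!addrA; congr (_ + _); rewrite addrCA.
Qed.

Hypothesis conn : forall d e, connect (linked (@ccw D) opp) d e.

Lemma colorless_cut x y : y \notin porbit ccw x ->
  exists A, [/\ vertex_set A, x \in A, y \notin A & (#|out_edges A| <= 1)%N].
Proof.
move=> xy; have [f [f_ccw f_lap]] := colorless_potential x y.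
exact: cut_of_potential f_ccw xy f_lap.
Qed.

(** A colorless diagram has a loop besides any given edge [p]: a minimal cut
that does not contain the edge [p] consists of a single vertex, for a larger one
could be cut again by submodularity. Of the two sides of any cut, at least one
does not contain this edge. *)
Lemma colorless_loop p :
  exists d, [/\ opp d \in porbit ccw d, d != p & d != opp p].
Proof.
pose good A := [&& [forall d, (d \in A) ==> (ccw d \in A)], A != set0,
  (#|out_edges A| <= 1)%N & ~~ ((p \in A) && (opp p \in A))].
have goodP A : reflect [/\ vertex_set A, A != set0, (#|out_edges A| <= 1)%N &
    ~~ ((p \in A) && (opp p \in A))] (good A).
  apply: (iffP and4P) => -[vA nA oA pA]; split=> //.
    by move=> d dA; move/forallP/(_ d): vA; rewrite dA.
  by apply/forallP=> d; apply/implyP; apply: vA.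
have [/existsP[A0 good0]|no_good] := boolP [exists A, good A]; last first.
  (* Without any cut the diagram has a single vertex, which carries two loops.
     *)
  have one y : y \in porbit ccw p.
    apply: contraNT no_good => yp; have [A [vA pA yA oA]] := colorless_cut yp.
    have vC := vertex_setC vA; have oC := card_out_edgesC Xall alt vA.
    have [opA|opA] := boolP (opp p \in A).
      apply/existsP; exists (~: A); apply/goodP; split=> //.
      - by apply/set0Pn; exists y; rewrite inE.
      - by rewrite oC.
      by rewrite !inE pA.
    apply/existsP; exists A; apply/goodP; split=> //.
      by apply/set0Pn; exists p.
    by rewrite (negbTE opA) andbF.
  exists (ccw2 p); split.
  - by have := one (opp (ccw2 p)); rewrite -!eq_porbit_mem /ccw2 !porbit_step.
  - by have [[_ -> _] _] := ccw_neqs (Xall p).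
  apply/eqP => E; have := over_opp alt p; rewrite -E over_ccw2 //.
  by case: (over p).
pose A := [arg min_(A < A0 | good A) #|A|].
have [goodA minA] : good A /\ forall B, good B -> (#|A| <= #|B|)%N.
  by rewrite /A; case: arg_minnP => // B gB mB; split.
have [vA nA oA pA] := goodP _ goodA; have [x0 x0A] := set0Pn _ nA.
have small B : vertex_set B -> B \proper A -> B != set0 ->
    (1 < #|out_edges B|)%N.
  move=> vB BA nB; rewrite ltnNge; apply/negP => oB.
  have /minA : good B.
    apply/goodP; split=> //; apply: contra pA => /andP[pB opB].
    by rewrite !(subsetP (proper_sub BA)).
  by rewrite leqNgt proper_card.
(* If [S] separates two vertices of [A], then either [A :&: S] or [~: S] is a
   smaller cut inside [A]. *)
have single y : y \in A -> y \in porbit ccw x0.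
  move=> yA; apply: contraT => x0y; have [S [vS xS yS oS]] := colorless_cut x0y.
  have := out_edges_submodular A S.
  have AS : (1 < #|out_edges (A :&: S)|)%N.
    apply: small; first exact: vertex_setI.
      apply/properP; split; first exact: subsetIl.
      by exists y => //; rewrite inE (negbTE yS) andbF.
    by apply/set0Pn; exists x0; rewrite inE x0A.
  have [U0|U_gt0] := posnP #|out_edges (A :|: S)|.
    have UT : A :|: S = [set: _].
      apply: (out_edges0 Xall alt conn (vertex_setU vA vS) U0 (d := x0)).
      by rewrite inE x0A.
    have CA : ~: S \proper A.
      apply/properP; split; last by exists x0 => //; rewrite inE xS.
      apply/subsetP=> z; rewrite inE => zS.
      by have : z \in A :|: S; [rewrite UT inE | rewrite inE (negbTE zS) orbF].
    have nC : ~: S != set0 by apply/set0Pn; exists y; rewrite inE.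
    have := small _ (vertex_setC vS) CA nC.
    by rewrite card_out_edgesC // ltnNge oS.
  by move: AS U_gt0 oS oA; lia.
have [x xx ox] : exists2 z, z \in porbit ccw x0 & over z.
  have [o|u] := boolP (over x0); first by exists x0; rewrite ?porbit_id.
  by exists (ccw x0); rewrite ?mem_porbit1 ?over_ccw.
have xA : x \in A by rewrite (vertex_setE vA xx).
have singleX y : y \in A -> y \in porbit ccw x.
  by move/single; move: xx; rewrite -!eq_porbit_mem => /eqP ->.
have noloop d : d \in A -> opp d \in A -> d != p /\ d != opp p.
  move=> dA odA; split; apply: contraNneq pA => E; rewrite E in dA odA.
    by rewrite dA.
  by rewrite opp_inv in odA; rewrite odA dA.
have [oxA|oxA] := boolP (opp x \in A).
  by exists x; have [] := noloop x xA oxA; split=> //; apply: singleX.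
have x2A : ccw2 x \in A by apply/vA/vA.
have ox2A : opp (ccw2 x) \in A.
  apply: contraT => ox2A; have [[_ n2 _] _] := ccw_neqs (Xall x).
  have := card_le1_eqP oA x (ccw2 x).
  rewrite !inE xA ox oxA x2A over_ccw2 // ox ox2A => /(_ isT isT) /eqP.
  by rewrite ?[x == _]eq_sym n2.
exists (ccw2 x); have [] := noloop (ccw2 x) x2A ox2A; split=> //.
by have := singleX _ ox2A; rewrite -!eq_porbit_mem /ccw2 !porbit_step.
Qed.

End Colorless.

(** * Splitting a diagram along a cut *)

Section SubPerm.
Variables (T : finType) (A : {set T}) (s : {perm T}).
Hypothesis sA : forall d, d \in A -> s d \in A.

Definition sub_perm_fun (u : {d : T | d \in A}) : {d : T | d \in A} :=
  exist _ (s (val u)) (sA (valP u)).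

Lemma sub_perm_inj : injective sub_perm_fun.
Proof. by move=> u v /(congr1 val) /perm_inj /val_inj. Qed.

(** The restriction of a permutation to a stable subset. *)
Definition sub_perm : {perm {d : T | d \in A}} := perm sub_perm_inj.

Lemma val_sub_perm u : val (sub_perm u) = s (val u).
Proof. by rewrite permE. Qed.

End SubPerm.

Section SplitType.
Variables (T : finType) (A : {set T}).

(** The identification of the disjoint union of [A] and its complement with the
whole type. *)
Definition glue (u : {d : T | d \in A} + {d : T | d \in ~: A}) : T :=
  match u with inl v => val v | inr v => val v end.

Lemma glue_bij : bijective glue.
Proof.
apply: inj_card_bij.
  move=> [[d dA]|[d dA]] [[e eA]|[e eA]] /= E; rewrite ?E in dA *.
  - by congr inl; apply: val_inj.
  - by exfalso; move: eA; rewrite inE dA.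
  - by exfalso; move: dA; rewrite inE eA.
  by congr inr; apply: val_inj.
by rewrite card_sum !card_sig cardsC.
Qed.

Lemma card_porbits_split (s : {perm T}) sA sC :
  #|porbits s| = (#|porbits (@sub_perm T A s sA)| +
                  #|porbits (@sub_perm T (~: A) s sC)|)%N.
Proof.
by apply: (card_porbits_sum glue_bij) => u; rewrite /= -val_sub_perm.
Qed.

End SplitType.

Section Split.
Variable D : diagram.
Hypotheses (Xall : crossings_only D) (alt : alternating D).
Hypothesis conn : forall d e, connect (linked (@ccw D) opp) d e.
Implicit Types (d e : dart D) (A : {set dart D}).

(** The edge of the dart [p] of [A] is the only one that leaves [A], and the
edge of the dart [q] of [A] the only one that enters [A]. *)
Definition is_cut A p q := [/\ vertex_set A, p \in A /\ q \in A,
  over p /\ ~~ over q &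
  forall d, d \in A -> (opp d \in A) = (d != p) && (d != q)].

Lemma is_cutC A p q : is_cut A p q -> is_cut (~: A) (opp q) (opp p).
Proof.
move=> [vA [pA qA] [op uq] cA]; split.
- exact: vertex_setC.
- by rewrite !inE !cA // !eqxx andbF.
- by rewrite !over_opp // op uq.
move=> d; rewrite !inE => dA; rewrite -!opp_eq.
have [odA|odA] := boolP (opp d \in A).
  by have := cA _ odA; rewrite opp_inv (negbTE dA) => /esym; rewrite andbC.
by apply/esym/andP; split; apply: contraNneq odA => ->.
Qed.

Lemma exists_cut A x y : vertex_set A -> x \in A -> y \notin A ->
  (#|out_edges A| <= 1)%N -> exists p q, is_cut A p q.
Proof.
move=> vA xA yA oA.
have o1 : #|out_edges A| = 1%N.
  apply/eqP; rewrite eqn_leq oA lt0n; apply: contraNneq yA => /eqP o0.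
  by rewrite (out_edges0 Xall alt conn vA (eqP o0) xA) inE.
have /eqP/cards1P[p pE] := o1.
have /eqP/cards1P[q qE] : #|in_edges A| = 1%N by rewrite card_in_edges.
have : p \in out_edges A by rewrite pE inE.
have : q \in in_edges A by rewrite qE inE.
rewrite !inE => /and3P[qA uq oqA] /and3P[pA op opA].
exists p, q; split=> // d dA.
have /setP/(_ d) := pE; have /setP/(_ d) := qE; rewrite !inE dA /= => <- <-.
by case: (over d); rewrite /= ?andbT ?negbK.
Qed.

(** The edges of [p] and [q] are cut, and their four ends are joined in the
other possible way: [p] to [q], [opp p] to [opp q]. *)
Definition cut_opp p q : {perm dart D} :=
  (tperm p (opp q) * (tperm q (opp p) * opp))%g.

Lemma cut_oppC p q : cut_opp (opp q) (opp p) = cut_opp p q.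
Proof. by rewrite /cut_opp !opp_inv tpermC [tperm (opp p) q]tpermC. Qed.

Section Cut.
Variables (A : {set dart D}) (p q : dart D).
Hypothesis cut : is_cut A p q.

Let vA : vertex_set A. Proof. by case: cut. Qed.
Let pA : p \in A. Proof. by case: cut => _ []. Qed.
Let qA : q \in A. Proof. by case: cut => _ []. Qed.
Let op : over p. Proof. by case: cut => _ _ []. Qed.
Let uq : ~~ over q. Proof. by case: cut => _ _ []. Qed.

Let opA : opp p \notin A.
Proof. by case: cut => _ _ _ ->; rewrite // eqxx. Qed.
Let oqA : opp q \notin A.
Proof. by case: cut => _ _ _ ->; rewrite // eqxx andbF. Qed.

Let pq : p != q. Proof. by apply: contraTneq op => ->. Qed.

Lemma cut_oppE d : cut_opp p q d =
  if d == p then q else if d == q then p else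
  if d == opp p then opp q else if d == opp q then opp p else opp d.
Proof.
have npop : p != opp p by rewrite eq_sym opp_neq.
have npoq : p != opp q by apply: contraNneq oqA => <-.
have nqop : q != opp p by apply: contraNneq opA => <-.
have nqoq : q != opp q by rewrite eq_sym opp_neq.
have opoq : opp p != opp q by rewrite opp_eq opp_inv.
have [oqop qp] : opp q != opp p /\ q != p by rewrite eq_sym opoq eq_sym.
have [nopp noqq] : opp p != p /\ opp q != q by rewrite !opp_neq.
rewrite /cut_opp !permM.
have [->|dp] := eqVneq d p.
  by rewrite tpermL tpermD ?opp_inv.
have [->|dq] := eqVneq d q.
  by rewrite [tperm p _ _]tpermD // tpermL opp_inv.
have [->|dop] := eqVneq d (opp p); first by rewrite [tperm p _ _]tpermD ?tpermR.
have [->|doq] := eqVneq d (opp q); first by rewrite tpermR tpermD.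
by rewrite !tpermD // eq_sym.
Qed.

Lemma cut_opp_inside d : d \in A -> d != p -> d != q -> cut_opp p q d = opp d.
Proof.
move=> dA dp dq; rewrite cut_oppE (negbTE dp) (negbTE dq).
case: eqP => [E|_]; first by move: dA; rewrite E (negbTE opA).
by case: eqP => [E|//]; move: dA; rewrite E (negbTE oqA).
Qed.

Lemma cut_opp_stable d : d \in A -> cut_opp p q d \in A.
Proof.
move=> dA; have [->|dp] := eqVneq d p; first by rewrite cut_oppE eqxx.
have [->|dq] := eqVneq d q; first by rewrite cut_oppE eqxx eq_sym (negbTE pq).
by rewrite cut_opp_inside //; case: cut => _ _ _ ->; rewrite ?dp.
Qed.

Lemma cut_opp_inv d : cut_opp p q (cut_opp p q d) = d.
Proof.
have npop : (opp p == p) = false by apply/negbTE/opp_neq.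
have npoq : (opp q == p) = false.
  by apply: contraNF oqA => /eqP ->.
have nqop : (opp p == q) = false.
  by apply: contraNF opA => /eqP ->.
have nqoq : (opp q == q) = false by apply/negbTE/opp_neq.
have nopoq : (opp q == opp p) = false.
  by rewrite opp_eq opp_inv eq_sym (negbTE pq).
have cp : cut_opp p q p = q by rewrite cut_oppE eqxx.
have cq : cut_opp p q q = p by rewrite cut_oppE eqxx eq_sym (negbTE pq).
have cop : cut_opp p q (opp p) = opp q by rewrite cut_oppE npop nqop eqxx.
have coq : cut_opp p q (opp q) = opp p by rewrite cut_oppE npoq nqoq nopoq eqxx.
have [->|dp] := eqVneq d p; first by rewrite cp.
have [->|dq] := eqVneq d q; first by rewrite cq.
have [->|dop] := eqVneq d (opp p); first by rewrite cop.
have [->|doq] := eqVneq d (opp q); first by rewrite coq.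
have -> : cut_opp p q d = opp d.
  by rewrite cut_oppE (negbTE dp) (negbTE dq) (negbTE dop) (negbTE doq).
rewrite cut_oppE !opp_eq !opp_inv.
by rewrite (negbTE dp) (negbTE dq) (negbTE dop) (negbTE doq).
Qed.

Lemma over_cut_opp d : over (cut_opp p q d) = ~~ over d.
Proof.
rewrite cut_oppE; case: eqP => [->|_]; first by rewrite op (negbTE uq).
case: eqP => [->|_]; first by rewrite op.
case: eqP => [->|_]; first by rewrite !over_opp // op.
by case: eqP => [->|_]; rewrite !over_opp // op ?(negbTE uq).
Qed.

Lemma cut_opp_neq d : cut_opp p q d != d.
Proof.
by apply/eqP => E; have := over_cut_opp d; rewrite E; case: (over d).
Qed.

(** The permutations of the part of the diagram inside [A], closed up by an edge
that joins [p] to [q]. *)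
Definition part_ccw := sub_perm vA.
Definition part_opp := sub_perm cut_opp_stable.

Lemma part_opp_inv u : part_opp (part_opp u) = u.
Proof. by apply: val_inj; rewrite !val_sub_perm cut_opp_inv. Qed.

Lemma part_opp_neq u : part_opp u != u.
Proof. by rewrite -val_eqE /= val_sub_perm cut_opp_neq. Qed.

Lemma part_connected u v : connect (linked part_ccw part_opp) u v.
Proof.
pose u0 : {d : dart D | d \in A} := exist _ p pA.
suff conn0 w : connect (linked part_ccw part_opp) u0 w.
  by apply: connect_trans (conn0 v); rewrite linked_connect_sym.
(* The connected component of [p] in the part, together with all the darts
   outside [A], is closed under [ccw] and [opp]. *)
pose C := [set d | if insub d is Some w
                   then connect (linked part_ccw part_opp) u0 w else true].
have CE w' : (val w' \in C) = connect (linked part_ccw part_opp) u0 w'.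
  by rewrite inE valK.
have Cout d : d \notin A -> d \in C by move=> dA; rewrite inE insubN.
have step w' (t : {perm {d : dart D | d \in A}}) :
    linked part_ccw part_opp w' (t w') -> val w' \in C -> val (t w') \in C.
  by rewrite !CE => l c; apply: connect_trans c (connect1 l).
have l_ccw w' : linked part_ccw part_opp w' (part_ccw w').
  by rewrite /linked /= eqxx.
have l_opp w' : linked part_ccw part_opp w' (part_opp w').
  by rewrite /linked /= eqxx orbT.
have pC : p \in C by rewrite -[p]/(val u0) CE connect0.
have qC : q \in C.
  have -> : q = val (part_opp u0) by rewrite val_sub_perm /= cut_oppE eqxx.
  by apply: step => //; rewrite CE connect0.
rewrite -CE; apply: (@linked_closed _ ccw opp C p) => // d dC.
  have [dA|dA] := boolP (d \in A); last first.
    by apply: Cout; rewrite (vertex_setE vA (mem_porbit1 _ _)).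
  have -> : ccw d = val (part_ccw (exist _ d dA)) by rewrite val_sub_perm.
  exact: step.
have [dA|dA] := boolP (d \in A); last first.
  have [odA|odA] := boolP (opp d \in A); last exact: Cout.
  have : opp (opp d) \notin A by rewrite opp_inv.
  case: cut => _ _ _ -> //; rewrite negb_and !negbK.
  by case/orP=> /eqP ->.
have [->|dp] := eqVneq d p; first exact: Cout.
have [->|dq] := eqVneq d q; first exact: Cout.
have -> : opp d = val (part_opp (exist _ d dA)).
  by rewrite val_sub_perm /= cut_opp_inside.
exact: step.
Qed.

Lemma part_euler : (#|porbits (part_opp * part_ccw)%g| + #|porbits part_ccw| <=
  #|porbits part_opp| + 2)%N.
Proof.
have := euler_inequality part_opp_inv part_connected.
have -> : moved part_opp = [set: _].
  by apply/setP=> u; rewrite !inE part_opp_neq.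
rewrite cardsT -(porbits_fixfree_involution part_opp_inv part_opp_neq).
by rewrite -addnn; lia.
Qed.

End Cut.

Section Planar.
Variables (A : {set dart D}) (p q : dart D).
Hypothesis cut : is_cut A p q.

(** Undoing the cut merges the face of [p] with that of [opp q], then the face
of [q] with that of [opp p]. Both mergers join distinct faces, the second one
because [over] is constant along the faces and tells those of [q] and [opp p]
from those of [p] and [opp q]. *)
Lemma cut_faces :
  #|porbits (cut_opp p q * ccw)%g| = (#|porbits (opp * @ccw D)%g|).+2.
Proof.
have [vA [pA qA] [op uq] cA] := cut.
have opA : opp p \notin A by rewrite cA // eqxx.
have oqA : opp q \notin A by rewrite cA // eqxx andbF.
set phi := (cut_opp p q * ccw)%g.
have phiA d : (phi d \in A) = (d \in A).
  rewrite permM (vertex_setE vA (mem_porbit1 _ _)).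
  apply/idP/idP; last exact: cut_opp_stable.
  apply: contraTT => dA; have : d \in ~: A by rewrite inE.
  by move=> /(cut_opp_stable (is_cutC cut)); rewrite cut_oppC inE.
have phi_over d : over (phi d) = over d.
  by rewrite permM over_ccw // (over_cut_opp cut) negbK.
pose psi := (tperm p (opp q) * phi)%g.
have E1 : #|porbits psi|.+1 = #|porbits phi|.
  apply: porbits_disjoint_merge; apply: contra oqA => pphi.
  by rewrite -(porbit_const (f := fun d => d \in A) phiA pphi).
pose chi := (tperm q (opp p) * psi)%g.
have E2 : #|porbits chi|.+1 = #|porbits psi|.
  apply: porbits_disjoint_merge; rewrite porbit_sym; apply: contra opA => pq.
  have /andP[] // : opp p \in [pred d | (d \in A) && ~~ over d].
  (* The orbit of [q] avoids [p] and [opp q], where [psi] differs from [phi]. *)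
  apply: (@porbit_closed _ psi _ q); rewrite ?inE ?qA //.
  move=> d; rewrite !inE => /andP[dA ud]; rewrite /psi permM tpermD.
  - by rewrite phiA phi_over dA ud.
  - by apply: contraNneq ud => <-.
  by apply: contraTneq dA => <-.
rewrite -E1 -E2; congr (#|porbits _|.+2).
rewrite /chi /psi /phi /cut_opp !mulgA -(mulgA (tperm q _) (tperm p _)).
by rewrite tperm2 mulg1 tperm2 mul1g.
Qed.

End Planar.

(** The Euler characteristics of the two parts add up to 4 and neither exceeds
2. *)
Lemma part_planar A p q (cut : is_cut A p q) :
  genus0 (part_ccw cut) (part_opp cut).
Proof.
have cutC := is_cutC cut.
have [vA [pA qA] _ _] := cut; have [vC [qC pC] _ _] := cutC.
have dC d : d \in ~: A -> cut_opp p q d \in ~: A.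
  by rewrite -(cut_oppC p q); apply: cut_opp_stable.
have dA := cut_opp_stable cut.
have fA d : d \in A -> (cut_opp p q * ccw)%g d \in A.
  by move=> /dA/vA; rewrite permM.
have fC d : d \in ~: A -> (cut_opp p q * ccw)%g d \in ~: A.
  by move=> /dC/vC; rewrite permM.
have one : n_comp (linked (@ccw D) opp) predT = 1%N.
  apply/eqP; rewrite eqn_leq n_comp_gt0 // andbT.
  exact/(n_comp1P ccw opp p).
have oneA : n_comp (linked (part_ccw cut) (part_opp cut)) predT = 1%N.
  pose u0 : {d : dart D | d \in A} := exist _ p pA.
  apply/eqP; rewrite eqn_leq n_comp_gt0 // andbT.
  exact/(n_comp1P _ _ u0)/part_connected.
have eA := part_euler cut; have eC := part_euler cutC.
have cV := card_porbits_split vA vC.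
have cF := card_porbits_split fA fC.
have cE := card_porbits_split dA dC.
have cT : #|porbits (cut_opp p q)| = #|porbits (@opp D)|.
  apply: double_inj.
  rewrite (porbits_fixfree_involution (cut_opp_inv cut) (cut_opp_neq cut)).
  by rewrite (porbits_fixfree_involution (@opp_inv D) (@opp_neq D)).
have := planar D; rewrite /genus0 one => pl.
have pF := cut_faces cut.
have vE : sub_perm vA = part_ccw cut.
  by apply/permP=> u; apply: val_inj; rewrite !val_sub_perm.
have vE' : sub_perm vC = part_ccw cutC.
  by apply/permP=> u; apply: val_inj; rewrite !val_sub_perm.
have oE : sub_perm dA = part_opp cut.
  by apply/permP=> u; apply: val_inj; rewrite !val_sub_perm.
have oE' : sub_perm dC = part_opp cutC.
  by apply/permP=> u; apply: val_inj; rewrite !val_sub_perm cut_oppC.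
have fE : sub_perm fA = (part_opp cut * part_ccw cut)%g.
  by apply/permP=> u; apply: val_inj; rewrite permM !val_sub_perm permM.
have fE' : sub_perm fC = (part_opp cutC * part_ccw cutC)%g.
  apply/permP=> u; apply: val_inj.
  by rewrite permM !val_sub_perm permM cut_oppC.
rewrite vE vE' in cV; rewrite oE oE' in cE; rewrite fE fE' in cF.
by rewrite /genus0 oneA; lia.
Qed.

Section Part.
Variables (A : {set dart D}) (p q : dart D).
Hypothesis cut : is_cut A p q.

Lemma part_ccw_order u :
  part_ccw cut (part_ccw cut (part_ccw cut (part_ccw cut u))) = u.
Proof. by apply: val_inj; rewrite !val_sub_perm ccw_order. Qed.

Lemma part_ccw_neq u : part_ccw cut u != u.
Proof. by rewrite -val_eqE /= val_sub_perm ccw_neq. Qed.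

Lemma part_over_alt (u : {d : dart D | d \in A}) :
  part_ccw cut (part_ccw cut u) != u ->
  over (val (part_ccw cut u)) = ~~ over (val u).
Proof. by rewrite val_sub_perm over_ccw. Qed.

(** The diagram formed by the part inside [A]. *)
Definition part : diagram :=
  @Diagram _ (part_ccw cut) (part_opp cut) (fun u => over (val u))
    (part_opp_inv cut) (part_opp_neq cut) part_ccw_order part_ccw_neq
    part_over_alt (part_planar cut).

Lemma val_part_ccw (u : dart part) : val (ccw u) = ccw (val u).
Proof. exact: val_sub_perm. Qed.

Lemma val_part_opp (u : dart part) : val (opp u) = cut_opp p q (val u).
Proof. exact: val_sub_perm. Qed.

Lemma part_crossings_only : crossings_only part.
Proof.
move=> u; rewrite /at_crossing /ccw2 -val_eqE /= !val_sub_perm.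
exact: Xall.
Qed.

Lemma part_alternating : alternating part.
Proof. by move=> u; rewrite /= val_sub_perm (over_cut_opp cut). Qed.

(** A loop of [part] other than the new edge is a loop of [D], and a loop makes
its crossing nugatory. *)
Lemma part_not_colorless : reduced D -> ~ colorless part.
Proof.
move=> red triv; have [_ [pA qA] _ _] := cut.
pose u0 : dart part := exist _ p pA.
have [u [u_loop nup nuop]] :=
  colorless_loop part_crossings_only part_alternating triv
    (part_connected cut) u0.
have oE : val (opp u) = opp (val u).
  rewrite val_part_opp (cut_opp_inside cut) ?(valP u) //.
  apply: contra nuop => /eqP uq; apply/eqP/val_inj; rewrite val_part_opp /= uq.
  by rewrite (cut_oppE cut) eqxx.
have over_u : over (opp u) != over u.
  by rewrite part_alternating; case: (over u).
have [E|E] := ccw_cases_neq part_crossings_only u_loop over_u.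
  have /negP := red (val u); apply; rewrite /nugatory Xall /=.
  have -> : ccw2 (val u) = (opp * ccw)%g (val u).
    by rewrite permM -oE E val_part_ccw.
  exact: mem_porbit1.
have /negP := red (opp (val u)); apply; rewrite /nugatory Xall /=.
have {}E : ccw (opp (val u)) = val u by rewrite -oE E -val_part_ccw ccw4.
rewrite /ccw2 E; have {1}-> : ccw (val u) = (opp * ccw)%g (opp (val u)).
  by rewrite permM opp_inv.
exact: mem_porbit1.
Qed.

End Part.

Lemma connected_sum_parts A p q (cut : is_cut A p q) :
  connected_sum (part cut) (part (is_cutC cut)) D.
Proof.
have cutC := is_cutC cut; have [_ [pA qA] _ _] := cut.
have [_ [oqA opA] _ _] := cutC.
pose d1 : dart (part cut) := exist _ p pA.
pose d2 : dart (part (is_cutC cut)) := exist _ (opp p) opA.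
have vd1 : val d1 = p by []. have vd2 : val d2 = opp p by [].
have vod1 : val (opp d1) = q by rewrite val_part_opp (cut_oppE cut) eqxx.
have vod2 : val (opp d2) = opp q.
  by rewrite val_part_opp (cut_oppE (is_cutC cut)) eqxx; case: eqP => // ->.
exists d1, d2, (@glue _ A); split.
- exact: glue_bij.
- by split=> u; rewrite /= val_sub_perm.
- by [].
- split; first by [].
  by change (opp (val (opp d1)) = val (opp d2)); rewrite vod1 vod2.
split=> u.
  rewrite !inE negb_or -!val_eqE vd1 vod1 => /andP[up uq].
  change (opp (val u) = val (opp u)).
  by rewrite val_part_opp (cut_opp_inside cut) // (valP u).
rewrite !inE negb_or -!val_eqE vd2 vod2 => /andP[up uq].
change (opp (val u) = val (opp u)).
by rewrite val_part_opp (cut_opp_inside (is_cutC cut)) // (valP u).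
Qed.

(** A prime reduced alternating diagram has no nontrivial cut. *)
Lemma prime_no_cut A p q : reduced D -> prime_link D -> ~ is_cut A p q.
Proof.
move=> red [_ _ prime] cut.
have [] := prime _ _ _ (rst_refl _ _ _) (connected_sum_parts cut).
  by move/trivial_knot_colorless; apply: part_not_colorless.
by move/trivial_knot_colorless; apply: part_not_colorless.
Qed.

End Split.

(** * Crossing matrices *)

Section Arcs.
Variable D : diagram.
Hypotheses (Xall : crossings_only D) (alt : alternating D).
Implicit Types (d e : dart D).

(** The darts of the arc that passes over the crossing of the over-dart [d]. *)
Definition strand d : {set dart D} := [set d; ccw2 d; opp d; opp (ccw2 d)].

Lemma strand_ccw2 d : strand (ccw2 d) = strand d.
Proof.
apply/setP=> e; rewrite !inE ccw2K -!orbA orbCA.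
by do 2!congr (_ || _); rewrite orbC.
Qed.

Lemma arc_of_over d : over d -> arc_of d = strand d.
Proof.
move=> od; apply/setP=> e; rewrite inE; apply/idP/idP.
  have closed z w : arc_step z w -> z \in strand d -> w \in strand d.
    rewrite /arc_step /= Xall /= /through Xall !inE -!orbA.
    move=> zw zd; case/or4P: zd zw => /eqP ->;
      rewrite ?opp_inv ?over_opp ?over_ccw2 // od /= ?ccw2K ?orbF;
      by do ?[case/orP]; move=> /eqP ->; rewrite eqxx ?orbT.
  have dd : d \in strand d by rewrite !inE eqxx.
  have last_d s z :
      path (@arc_step D) z s -> z \in strand d -> last z s \in strand d.
    by elim: s z => //= w s IHs z /andP[zw ws] zd; apply/(IHs w ws)/(closed z).
  by move=> /connectP[s ds ->]; apply: last_d.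
have step_opp z : connect (@arc_step D) z (opp z).
  by apply: connect1; rewrite /arc_step /= eqxx.
have step_ccw2 : connect (@arc_step D) d (ccw2 d).
  by apply: connect1; rewrite /arc_step /= Xall od /through Xall eqxx orbT.
rewrite !inE -!orbA; case/or4P=> /eqP -> //.
exact: connect_trans step_ccw2 (step_opp _).
Qed.

Lemma over_arc_strand d : over d -> over_arc (porbit ccw d) = strand d.
Proof.
move=> od; apply/setP=> e; apply/bigcupP/idP.
  case=> z /andP[zd oz]; rewrite arc_of_over //.
  by have [->|->] := ccw_cases Xall zd (etrans oz (esym od));
    rewrite ?strand_ccw2.
by move=> ed; exists d; rewrite ?porbit_id // arc_of_over.
Qed.

Lemma sum_strand (R : nmodType) (F : dart D -> R) d : over d ->
  \sum_(e in strand d) F e = F d + F (ccw2 d) + F (opp d) + F (opp (ccw2 d)).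
Proof.
move=> od; have [[_ n2 _] _] := ccw_neqs (Xall d).
have no e z : over e = over z -> (opp e == z) = false.
  by move=> E; apply: contraTF isT => /eqP oe; move: E; rewrite -oe over_opp //;
    case: (over e).
have o2 : over (ccw2 d) = over d by rewrite over_ccw2.
have n3 : opp d \notin [set opp (ccw2 d)].
  by rewrite inE opp_eq opp_inv eq_sym n2.
have n4 : ccw2 d \notin opp d |: [set opp (ccw2 d)].
  by rewrite !inE ![ccw2 d == _]eq_sym !no.
have n5 : d \notin ccw2 d |: (opp d |: [set opp (ccw2 d)]).
  by rewrite !inE ![d == _]eq_sym n2 !no.
by rewrite /strand -!setUA !big_setU1 //= big_set1 !addrA.
Qed.

(** The total Laplacian vanishes, since as many edges enter a vertex as leave
it. *)
Lemma sum_lap (R : zmodType) (f : dart D -> R) :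
  (forall d, f (ccw d) = f d) -> \sum_(d | over d) lap f d = 0.
Proof.
move=> f_ccw.
have under : \sum_(d | over d) f (opp d) = \sum_(d | over d) f d.
  rewrite [LHS](reindex_inj (@perm_inj _ opp)) /=.
  rewrite [RHS](reindex_inj (@perm_inj _ ccw)) /=.
  by apply: eq_big => d; rewrite ?over_opp ?over_ccw // opp_inv f_ccw.
have under2 : \sum_(d | over d) f (opp (ccw2 d)) = \sum_(d | over d) f d.
  rewrite -under [RHS](reindex_inj (inv_inj (@ccw2K D))) /=.
  by apply: eq_bigl => d; rewrite over_ccw2.
by rewrite /lap !sumrB big_split /= under under2 addrK subrr.
Qed.

(** An equality of Laplacians with total mass zero needs only be checked away
from one vertex. *)
Lemma lap_eq_away (R : numDomainType) (f h : dart D -> R) d0 :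
    (forall d, f (ccw d) = f d) -> (forall d, h (ccw d) = h d) ->
    \sum_(d | over d) h d = 0 ->
    (forall d, over d -> d \notin porbit ccw d0 -> lap f d = h d) ->
  forall d, over d -> lap f d = h d.
Proof.
move=> f_ccw h_ccw h0 fh d od.
have [dd0|] := boolP (d \in porbit ccw d0); last exact: fh.
have orb z : (z \in porbit ccw d0) = (z \in porbit ccw d).
  by move: dd0; rewrite -!eq_porbit_mem => /eqP ->.
have : \sum_(z | over z) (lap f z - h z) = 0.
  by rewrite sumrB sum_lap // h0 subrr.
rewrite (bigID (fun z => z \in porbit ccw d)) /=.
rewrite [X in _ + X]big1 ?addr0; last first.
  by move=> z /andP[oz zd]; rewrite fh ?subrr // orb.
rewrite sum_vertex_over //.
have -> : lap f (ccw2 d) = lap f d.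
  by rewrite /lap ccw2K /ccw2 !f_ccw addrAC.
have -> : h (ccw2 d) = h d by rewrite /ccw2 !h_ccw.
by rewrite -mulr2n => /eqP; rewrite mulrn_eq0 /= subr_eq0 => /eqP.
Qed.

End Arcs.

Section Matrix.
Variables (D : diagram) (m : nat) (c : 'I_m.+1 -> {set dart D}).
Hypotheses (Xall : crossings_only D) (alt : alternating D).
Hypothesis conn : forall d e, connect (linked (@ccw D) opp) d e.
Hypothesis c_inj : injective c.
Hypothesis c_enum : [set c i | i : 'I_m.+1] = crossings D.
Implicit Types (d e : dart D).

Lemma crossing_index d : exists i, porbit ccw d = c i.
Proof.
have := mem_crossings (Xall d); rewrite -c_enum => /imsetP[i _ E]; by exists i.
Qed.

(** The index of the vertex of a dart. *)
Definition vindex d : 'I_m.+1 :=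
  odflt ord0 [pick i | porbit ccw d == c i].

Lemma vindexE d : c (vindex d) = porbit ccw d.
Proof.
rewrite /vindex; case: pickP => [i /eqP -> //|none].
by have [i E] := crossing_index d; have := none i; rewrite E eqxx.
Qed.

Lemma vindex_ccw d : vindex (ccw d) = vindex d.
Proof. by apply: c_inj; rewrite !vindexE porbit_step. Qed.

Lemma mem_vindex d i : (d \in c i) = (vindex d == i).
Proof.
apply/idP/eqP => [|<-]; last by rewrite vindexE porbit_id.
have : c i \in crossings D by rewrite -c_enum imset_f.
rewrite inE => /andP[/imsetP[e _ E] _]; rewrite E -eq_porbit_mem => /eqP dE.
by apply: c_inj; rewrite vindexE dE.
Qed.

Lemma over_dart i : exists2 d, over d & vindex d = i.
Proof.
have : c i \in crossings D by rewrite -c_enum imset_f.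
rewrite inE => /andP[/imsetP[e _ E] _].
have ei : vindex e = i by apply: c_inj; rewrite vindexE.
have [oe|ue] := boolP (over e); first by exists e.
by exists (ccw e); rewrite ?over_ccw ?vindex_ccw.
Qed.

Lemma over_arc_vindex d : over d -> over_arc (c (vindex d)) = strand d.
Proof. by move=> od; rewrite vindexE over_arc_strand. Qed.

Lemma over_arc_inj : injective (fun i => over_arc (c i)).
Proof.
move=> i j /=; have [d od <-] := over_dart i; have [e oe <-] := over_dart j.
rewrite !over_arc_vindex // => /setP/(_ d); rewrite !inE eqxx -!orbA /=.
case/esym/or4P => /eqP E; rewrite E /ccw2 ?vindex_ccw //.
  by move: od; rewrite E over_opp // oe.
by move: od; rewrite E over_opp // over_ccw2 // oe.
Qed.

(** The crossing matrix acts on row vectors as the Laplacian on functions. *)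
Lemma mul_crossing_matrix (R : pzRingType) (v : 'I_m.+1 -> R) d : over d ->
  \sum_i v i * (crossing_matrix c i (vindex d))%:~R = lap (v \o vindex) d.
Proof.
move=> od; rewrite /lap /=.
have oc2 : over (ccw2 d) by rewrite over_ccw2.
pose F e := v (vindex e) * (if over e then 1 else -1).
have -> : v (vindex d) + v (vindex d) - v (vindex (opp d))
    - v (vindex (opp (ccw2 d))) = \sum_(e in strand d) F e.
  rewrite sum_strand // /F od oc2 !over_opp // od oc2 /= !mulr1 !mulrN1.
  by rewrite /ccw2 !vindex_ccw.
rewrite (partition_big vindex predT) //=; apply: eq_bigr => i _.
rewrite mxE over_arc_vindex // /crossing_coef rmorph_sum mulr_sumr.
apply: eq_big => e; first by rewrite inE mem_vindex andbC.
rewrite inE mem_vindex => /andP[/eqP ei _].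
by rewrite /F ei; case: (over e); rewrite ?rmorphN rmorph1.
Qed.

(** The extension of a function on all crossings but the last one by the value 0
at the last one. *)
Definition extend0 (R : nmodType) (u : 'I_m -> R) (i : 'I_m.+1) : R :=
  if unlift ord_max i is Some i' then u i' else 0.

Lemma extend0_lift (R : nmodType) (u : 'I_m -> R) i :
  extend0 u (lift ord_max i) = u i.
Proof. by rewrite /extend0 liftK. Qed.

Lemma extend0_max (R : nmodType) (u : 'I_m -> R) : extend0 u ord_max = 0.
Proof. by rewrite /extend0 unlift_none. Qed.

Lemma mul_reduced_crossing_matrix (R : pzRingType) (u : 'I_m -> R) k d :
    over d -> vindex d = lift ord_max k ->
  \sum_i u i * (reduced_crossing_matrix c i k)%:~R =
    lap (extend0 u \o vindex) d.
Proof.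
move=> od dk; rewrite -mul_crossing_matrix // dk.
rewrite (bigD1_ord ord_max) //= extend0_max mul0r add0r.
by apply: eq_bigr => i _; rewrite extend0_lift !mxE.
Qed.

Lemma porbit_vindex d e : (e \in porbit ccw d) = (vindex e == vindex d).
Proof. by rewrite -vindexE mem_vindex. Qed.

Lemma reduced_crossing_matrix_unit :
  map_mx intr (reduced_crossing_matrix c) \in @unitmx rat m.
Proof.
rewrite -row_free_unit; apply: inj_row_free => u uC.
pose f := extend0 (fun i => u 0 i) \o vindex.
have f_ccw d : f (ccw d) = f d by rewrite /f /= vindex_ccw.
have [d0 od0 d0_max] := over_dart ord_max.
have f_lap d : over d -> lap f d = 0.
  move=> od; apply: (lap_eq_away Xall alt (h := fun=> 0) (d0 := d0)) => //.
    by rewrite big1.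
  move=> {od} {}d od; rewrite porbit_vindex d0_max.
  case: (unliftP ord_max (vindex d)) => [k dk _|->]; last by rewrite eqxx.
  rewrite -(mul_reduced_crossing_matrix _ od dk).
  transitivity ((u *m map_mx intr (reduced_crossing_matrix c)) 0 k).
    by rewrite mxE; apply: eq_bigr => i _; rewrite [map_mx _ _ _ _]mxE.
  by rewrite uC mxE.
apply/rowP=> i; rewrite mxE; have [d od di] := over_dart (lift ord_max i).
have := harmonic_constant Xall alt conn f_ccw f_lap d d0.
by rewrite /f /= di d0_max extend0_lift extend0_max.
Qed.

(** If the difference of two arcs, the base arc being 0, is an integral
combination of the rows of the reduced crossing matrix, then the diagram has a
cut. *)
Lemma cut_of_row_combination (u : 'I_m -> int) (i j : 'I_m.+1) : i != j ->
    (forall k, \sum_l u l * reduced_crossing_matrix c l k =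
       (lift ord_max k == i)%:R - (lift ord_max k == j)%:R) ->
  exists A p q, @is_cut D A p q.
Proof.
move=> ij u_rel; pose f := extend0 u \o vindex.
have f_ccw d : f (ccw d) = f d by rewrite /f /= vindex_ccw.
have [x ox xi] := over_dart i; have [y oy yj] := over_dart j.
have [d0 od0 d0_max] := over_dart ord_max.
pose h d : int := (d \in porbit ccw x)%:R - (d \in porbit ccw y)%:R.
have h_ccw d : h (ccw d) = h d by rewrite /h !porbit_vindex vindex_ccw.
have mass (z : dart D) :
    over z -> \sum_(d | over d) (d \in porbit ccw z)%:R = 2 :> int.
  move=> oz; transitivity (\sum_(d | over d && (d \in porbit ccw z)) 1 : int).
    by rewrite [RHS]big_mkcondr; apply: eq_bigr => d _; case: (d \in _).
  by rewrite sum_vertex_over.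
have h0 : \sum_(d | over d) h d = 0 by rewrite sumrB !mass // subrr.
have f_lap d : over d -> lap f d = h d.
  move=> od; apply: (lap_eq_away Xall alt (d0 := d0)) => // {od} {}d od.
  rewrite porbit_vindex d0_max.
  case: (unliftP ord_max (vindex d)) => [k dk _|->]; last by rewrite eqxx.
  rewrite -(mul_reduced_crossing_matrix _ od dk) /h !porbit_vindex dk xi yj.
  by rewrite -u_rel; apply: eq_bigr => l _; rewrite intz.
have xy : y \notin porbit ccw x by rewrite porbit_vindex yj xi eq_sym.
have [A [vA xA yA oA]] := cut_of_potential Xall alt conn f_ccw xy f_lap.
have [p [q cut]] := exists_cut Xall alt conn vA xA yA oA.
by exists A, p, q.
Qed.

(** If [n] annihilates the reduced group of colorings, then [n] times the
inverse of the reduced crossing matrix is integral: its [k]-th row gives the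
coefficients of [n] times the [k]-th arc on the crossing relators, normalized to
avoid the last relator, which is minus the sum of the others. *)
Lemma reduced_crossing_matrix_left_inverse n :
    (forall x : Colred (over_arc (c ord_max)), x *+ n = 0) ->
  exists L : 'M[int]_m, L *m reduced_crossing_matrix c = n%:R%:M.
Proof.
move=> ann; pose b := over_arc (c ord_max).
have arcP i : over_arc (c i) \in arcs D.
  have [d od <-] := over_dart i; rewrite over_arc_vindex // -arc_of_over //.
  exact: imset_f.
pose arc i : arc_type D := exist _ (over_arc (c i)) (arcP i).
pose F (o : option {set dart D}) :=
  if o is Some X then crossing_relator X else arc_generator b.
pose r := None :: [seq Some X | X <- enum (crossings D)].
have Ur : uniq r.
  rewrite /= map_inj_uniq ?enum_uniq ?andbT; last by move=> X Y [].
  by apply/negP => /mapP[].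
have sE : arc_generator b :: [seq crossing_relator X | X <- enum (crossings D)]
    = [seq F o | o <- r].
  by rewrite /r /= -map_comp.
have row k : exists v : 'I_m.+1 -> int, v ord_max = 0 /\
    forall k', \sum_i v i * crossing_matrix c i (lift ord_max k') =
      n%:R * (k == k')%:R.
  pose g := arc_generator (over_arc (c (lift ord_max k))).
  have /(pres_class_span Ur sE)[a aE] :
      pres_class (arc_generator b ::
        [seq crossing_relator X | X <- enum (crossings D)]) (g *+ n) =
      pres_class _ 0.
    rewrite pres_classMn [LHS](ann (pres_class _ g)).
    exact/esym/(raddf0 (pres_class _)).
  pose w i := a (Some (c i)).
  have w_mat k' : \sum_i w i * crossing_matrix c i (lift ord_max k') =
      n%:R * (k == k')%:R.
    have := congr1
      (fun z : {ffun arc_type D -> int} => z (arc (lift ord_max k'))) aE.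
    rewrite subr0 ffunMnE !ffunE /= (inj_eq over_arc_inj) (inj_eq lift_inj).
    rewrite sum_ffunE /r big_cons ffun_intmul ffunE /= (inj_eq over_arc_inj).
    rewrite [_ == ord_max]eq_sym (negbTE (neq_lift _ _)) mul0r add0r.
    rewrite big_map big_enum /=.
    rewrite -c_enum big_imset /=; last by move=> i j _ _ /c_inj.
    move=> E; transitivity ((if k' == k then 1 else 0) *+ n : int).
      rewrite E; apply: eq_big => [i|i _]; first by rewrite inE.
      by rewrite ffun_intmul ffunE mulrC mxE.
    by rewrite eq_sym mulr_natl; case: (k == k').
  (* Subtracting a constant from the coefficients changes nothing, since
     constants have zero Laplacian. *)
  exists (fun i => w i - w ord_max); split=> [|k']; first exact: subrr.
  have [d od dk] := over_dart (lift ord_max k').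
  have lapE' v : \sum_i v i * crossing_matrix c i (lift ord_max k') =
      lap (v \o vindex) d :> int.
    rewrite -mul_crossing_matrix // dk.
    by apply: eq_bigr => i _; rewrite intz.
  rewrite -w_mat !lapE' /lap /=.
  set s1 := w ord_max; ring.
have {row} [v v_spec] := choice row.
exists (\matrix_(k, i) v k (lift ord_max i)); apply/matrixP=> k k'.
have [v0 vM] := v_spec k; rewrite !mxE -[n%:R *+ _]mulr_natr -vM.
rewrite [RHS](bigD1_ord ord_max) //= v0 mul0r add0r.
by apply: eq_bigr => i _; rewrite !mxE.
Qed.

End Matrix.

(** * Distinguishing arcs *)

Theorem theorem3p5 (D : diagram) (m : nat) (c : 'I_m.+1 -> {set dart D}) (n1 : nat)
    (D_crossings : crossings_only D)
    (D_reduced : reduced D) (D_alternating : alternating D)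
    (D_prime : prime_link D)
    (c_inj : injective c) (c_enum : [set c i | i : 'I_m.+1] = crossings D)
    (n1_largest : largest_invariant_factor (Colred (over_arc (c ord_max))) n1) :
  let C : 'M[rat]_m := map_mx intr (reduced_crossing_matrix c) in
  C \in unitmx /\
  exists L : 'M[int]_m,
    map_mx intr L = n1%:R *: invmx C /\
    forall i j : 'I_m.+1, i != j ->
      exists k : 'I_m, (color L i k != color L j k %[mod n1])%Z.
Proof.
have conn : forall d e, connect (linked (@ccw D) opp) d e.
  move=> d; have := D_prime; case=> _ nsplit _; move: d.
  have [d0 _ _] := over_dart D_crossings c_inj c_enum ord_max.
  apply/(n_comp1P _ _ d0); rewrite leqNgt; apply/negP => split.
  by apply: nsplit; exists D => //; apply: rst_refl.
set C := map_mx _ _; move=> CE.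
have C_unit : CE \in unitmx.
  exact: (reduced_crossing_matrix_unit D_crossings D_alternating conn c_inj
    c_enum).
split=> //.
have ann x := (largest_invariant_factor_annihilates x n1_largest).2.
have n1_gt1 := (largest_invariant_factor_annihilates 0 n1_largest).1.
have [L LC] := reduced_crossing_matrix_left_inverse D_crossings D_alternating
  c_inj c_enum ann.
exists L; split.
  have : map_mx intr L *m CE = n1%:R%:M.
    by rewrite -map_mxM LC map_scalar_mx /= rmorph_nat.
  by move/(congr1 (fun M => M *m invmx CE)); rewrite mulmxK // mul_scalar_mx.
move=> i j ij; apply/existsP; apply: contraT.
rewrite negb_exists => /forallP same.
have dvd k : (n1 %| color L i k - color L j k)%Z.
  by have := same k; rewrite negbK eqz_mod_dvd.
(* [u] is the difference of the rows [i] and [j] of the inverse of [C]. *)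
pose u k := ((color L i k - color L j k) %/ n1)%Z.
have uE k : color L i k - color L j k = u k * n1%:Z by rewrite divzK.
have colorC i0 k : \sum_l color L i0 l * reduced_crossing_matrix c l k =
    n1%:Z * (lift ord_max k == i0)%:R.
  rewrite -natz /color; case: (unliftP ord_max i0) => [i1 ->|->].
    have := congr1 (fun M : 'M_m => M i1 k) LC; rewrite !mxE (inj_eq lift_inj).
    by rewrite eq_sym mulr_natr.
  rewrite big1 => [|l _]; last by rewrite mul0r.
  by rewrite eq_sym (negbTE (neq_lift _ _)) mulr0.
have [|A [p [q cut]]] :=
  cut_of_row_combination D_crossings D_alternating conn c_inj c_enum ij
    (u := u).
  move=> k; have n1_neq0 : n1%:Z != 0 by case: (n1) n1_gt1.
  apply: (mulfI n1_neq0); rewrite mulr_sumr mulrBr -!colorC -sumrB.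
  by apply: eq_bigr => l _; rewrite -mulrBl uE mulrA [_ * u l]mulrC.
by case: (prime_no_cut D_crossings D_alternating conn D_reduced D_prime cut).
Qed.
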